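(* Let $(\mathbb{R}^n,g)$ be a pseudo-Euclidean space, $n\ge3$, with coordinates $x=(x_1,\dots,x_n)$ and $g_{ij}=\delta_{ij}\varepsilon_i$. Consider smooth functions $f(\xi)$, $h(\xi)$ and $\varphi(\xi)$, where $\xi=\sum_{i=1}^n\alpha_ix_i$, $\alpha_i\in\mathbb{R}$, and $\sum_{i=1}^n\varepsilon_i\alpha_i^2=\varepsilon_{i_0}$, given by $$\begin{cases}f_\pm(\xi)=c_1[(a-rN_\pm)\xi+c]^{-\frac1{a-rN_\pm}}\\ h_\pm(\xi)=c_2[(a-rN_\pm)\xi+c]^{-\frac{N_\pm}{a-rN_\pm}}\\ \varphi_\pm(\xi)=c_3[(a-rN_\pm)\xi+c]^{-\frac{k}{a-rN_\pm}}\end{cases}$$ with $k,c_1,c_2,c_3,N_\pm\in\mathbb{R}$, $k,c_1,c_2,c_3>0$, $c\in\mathbb{R}$, $$N_\pm=\frac{r(k+a)\pm\sqrt{r^2(k+a)^2-r(r-1)(a^2-b)}}{r(r-1)},\qquad r>0,\quad r\neq1,\quad r(k+a)^2\ge(r-1)(a^2-b),$$ $a=(n-2)k-m$ and $b=m(2k+1)-(n-2)k^2$. Then $(\mathbb{R}^n\times_fF^m,\widetilde g,h)$ is a quasi-Einstein semi-Riemannian manifold with $\rho=0$, i.e. $$\mathrm{Ric}_{\widetilde g}-\frac rh\mathrm{Hess}_{\widetilde g}h=0,$$ where $\widetilde g=\overline g+f^2g_F$, $\overline g=\frac1{\varphi^2}g$ and $F$ is Ricci-flat. These solutions are defined on the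 half space defined by $\sum_{i=1}^n\alpha_ix_i>-\frac{c}{a-rN_\pm}$.
   Context: Here $\varepsilon_i=\pm1$, $\varepsilon_{i_0}\in\{1,-1\}$, $r\in\mathbb{N}$, and $(F^m,g_F)$ is a semi-Riemannian manifold of dimension $m\ge1$. The triple $(f,h,\varphi)$ is $(f_+,h_+,\varphi_+)$ or $(f_-,h_-,\varphi_-)$. The warped product $\mathbb{R}^n\times_fF^m$ is the product of the base (the part of $\mathbb{R}^n$ where the functions are defined, with metric $\overline g$) and $F$, with the metric $\widetilde g=\overline g+f^2g_F$; functions on the base are regarded as functions on the product via the projection. A semi-Riemannian manifold $(M,\widetilde g)$ with a smooth function $h$ is quasi-Einstein if $\mathrm{Ric}_{\widetilde g}-\frac rh\mathrm{Hess}_{\widetilde g}h=\rho\,\widetilde g$ for a constant $\rho\in\mathbb{R}$.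
   Formalization: For the + sign, a−rN_+ is always negative, so the functions are undefined on the stated half space ξ > −c/(a−rN_+); the formal theorem uses ξ < −c/(a−rN_+) there, and keeps ξ > −c/(a−rN_−) for the − sign. *)

(* Defs.v *)
From HB Require Import structures.
From mathcomp Require Import all_boot all_order all_algebra.
From mathcomp Require Import all_classical all_reals all_analysis.

Set Implicit Arguments.
Unset Strict Implicit.
Unset Printing Implicit Defensive.
Import Order.TTheory GRing.Theory Num.Theory.
Import numFieldNormedType.Exports.
Local Open Scope classical_set_scope.
Local Open Scope ring_scope.

Section Smooth.
Context {R : realType} {d : nat}.

(* f is of class C^N on U; only meant for open U *)
Fixpoint class_C (N : nat) (U : set 'rV[R]_d) (f : 'rV[R]_d -> R) : Prop :=
  (forall x, U x -> {for x, continuous f}) /\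
  match N with
  | 0%N => True
  | N'.+1 => forall k : 'I_d,
      (forall x, U x -> derivable f x (delta_mx 0 k)) /\
      class_C N' U ('D_(delta_mx 0 k) f)
  end.

Definition smooth_on (U : set 'rV[R]_d) (f : 'rV[R]_d -> R) : Prop :=
  forall N, class_C N U f.

(* The index of a symmetric bilinear form: the largest dimension of a subspace
   on which the form is negative definite. *)
Definition negative_definite_on (G W : 'M[R]_d) : Prop :=
  forall v : 'rV[R]_d, (v <= W)%MS -> v != 0 -> (v *m G *m v^T) 0 0 < 0.

Definition has_index (G : 'M[R]_d) (nu : nat) : Prop :=
  (exists2 W : 'M[R]_d, negative_definite_on G W & \rank W = nu) /\
  (forall W : 'M[R]_d, negative_definite_on G W -> (\rank W <= nu)%N).

End Smooth.

(* An atlas on M together with a field of d x d matrices in each chart: coord c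
   and metric c are only meaningful on dom c, where metric c p holds the
   components at p of a (0,2)-tensor in the coordinates coord c. *)
Record metric_atlas (R : realType) (d : nat) (M : topologicalType) :=
  MetricAtlas {
    chart : Type;
    dom : chart -> set M;
    coord : chart -> M -> 'rV[R]_d;
    metric : chart -> M -> 'M[R]_d
  }.

Section Geometry.
Context {R : realType} {d : nat} {M : topologicalType}.
Variable A : metric_atlas R d M.
Implicit Types (c : chart A) (p q : M).

(* Coordinate expression of F in the chart c, i.e. the composite of F with the
   inverse of coord c on coord c @` dom c, and 0 elsewhere. *)
Definition in_coord (W : zmodType) c (F : M -> W) : 'rV[R]_d -> W :=
  fun x => xget 0 (F @` (dom c `&` coord c @^-1` [set x])).

(* (d/dx_k) F at p, for the coordinates of the chart c *)
Definition partial c (k : 'I_d) (F : M -> R) : M -> R :=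
  fun p => 'D_(delta_mx 0 k) (in_coord c F) (coord c p).

Definition smooth_function (F : M -> R) : Prop :=
  forall c, smooth_on (coord c @` dom c) (in_coord c F).

Definition is_chart c : Prop :=
  [/\ open (dom c),
      {in dom c &, injective (coord c)},
      forall p, dom c p -> {for p, continuous (coord c)} &
      forall U : set M, open U -> U `<=` dom c -> open (coord c @` U)].

(* The (k, l) entry is dy_l/dx_k, with x the coordinates of c and y those of c'. *)
Definition jacobian_mx c c' p : 'M[R]_d :=
  \matrix_(k, l) partial c k (fun q => coord c' q 0 l) p.

Definition semi_riemannian : Prop :=
  [/\ hausdorff_space M /\ @second_countable M,
      (forall c, is_chart c) /\ (forall p, exists c, dom c p),
      forall c c' (k : 'I_d),
        smooth_on (coord c @` (dom c `&` dom c'))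
                  (in_coord c (fun p => coord c' p 0 k)),
      [/\ forall c p, dom c p ->
            (metric c p)^T = metric c p /\ metric c p \in unitmx,
          forall c (i j : 'I_d),
            smooth_on (coord c @` dom c)
                      (in_coord c (fun p => metric c p i j)) &
          forall c c' p, dom c p -> dom c' p ->
            let J := jacobian_mx c c' p in
            metric c p = J *m metric c' p *m J^T] &
      exists nu, forall c p, dom c p -> has_index (metric c p) nu].

(* christoffel c k i j = Gamma^k_{ij} *)
Definition christoffel c (k i j : 'I_d) : M -> R := fun p =>
  2^-1 * \sum_l invmx (metric c p) k l *
    (partial c i (fun q => metric c q j l) p
     + partial c j (fun q => metric c q i l) p
     - partial c l (fun q => metric c q i j) p).

(* curvature c l k i j is the l-th component of
   R(d_i, d_j) d_k = nabla_i nabla_j d_k - nabla_j nabla_i d_k *)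
Definition curvature c (l k i j : 'I_d) : M -> R := fun p =>
  partial c i (christoffel c l j k) p - partial c j (christoffel c l i k) p
  + \sum_s (christoffel c l i s p * christoffel c s j k p
            - christoffel c l j s p * christoffel c s i k p).

(* the contraction for which round spheres have positive Ricci curvature *)
Definition ricci c p : 'M[R]_d :=
  \matrix_(j, k) \sum_i curvature c i k i j p.

Definition hessian c (h : M -> R) p : 'M[R]_d :=
  \matrix_(i, j) (partial c i (partial c j h) p
                  - \sum_k christoffel c k i j p * partial c k h p).

Definition ricci_flat : Prop := forall c p, dom c p -> ricci c p = 0.

(* Ric - (r / h) Hess h = rho g, compared in the charts of the atlas *)
Definition quasi_einstein (r : R) (h : M -> R) (rho : R) : Prop :=
  [/\ semi_riemannian, smooth_function h, forall p, h p != 0 &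
      forall c p, dom c p ->
        ricci c p - (r / h p) *: hessian c h p = rho *: metric c p].

End Geometry.

(* A subset D of R^n with its identity chart and the metric
   sum_ij G_ij dx_i dx_j *)
Definition euclidean_domain (R : realType) (n : nat) (D : set 'rV[R]_n)
    (G : 'rV[R]_n -> 'M[R]_n) : metric_atlas R n (set_type D) :=
  @MetricAtlas R n (set_type D) unit
    (fun=> [set: set_type D]) (fun=> set_val) (fun _ x => G (set_val x)).

(* g_B + f^2 g_F on the product B * F, with the product charts *)
Definition warped_product (R : realType) (n m : nat) (B F : topologicalType)
    (gB : metric_atlas R n B) (f : B -> R) (gF : metric_atlas R m F) :
    metric_atlas R (n + m) (B * F)%type :=
  @MetricAtlas R (n + m) (B * F)%type (chart gB * chart gF)%type
    (fun c => dom c.1 `*` dom c.2)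
    (fun c p => row_mx (coord c.1 p.1) (coord c.2 p.2))
    (fun c p => block_mx (metric c.1 p.1) 0
                         0 (f p.1 ^+ 2 *: metric c.2 p.2)).

(* Main.v *)
(** With s = A xi + c the logarithmic derivatives of f, h and phi with respect
    to xi are -1/s, -N/s and -k/s.  In a product chart each Christoffel symbol of
    the warped metric is then either one of F, or a constant times a power of s,
    possibly times a component of the metric of F.  Hence every block of
    Ric - (r/h) Hess h is a combination of A - a + r N, which vanishes by the
    definition of A, and of r (r - 1) N^2 - 2 r (k + a) N + a^2 - b, whose roots
    are N_+ and N_-.  The sign of A comes from
    disc - (a + r k)^2 = (r - 1) (a^2 + r ((n - 2) k^2 + m)) > 0.

    The index of the warped metric is the sum of those of base and fibre, because
    the orthogonal complement of a maximal negative definite subspace is positive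
    semidefinite and bounds the dimension of any negative definite subspace. *)

From Pilot Require Import Defs.
From HB Require Import structures.
From mathcomp Require Import all_boot all_order all_algebra.
From mathcomp Require Import all_classical all_reals all_analysis.
From mathcomp Require Import ring lra.
Set Implicit Arguments.
Unset Strict Implicit.
Unset Printing Implicit Defensive.
Import Order.TTheory GRing.Theory Num.Theory.
Import numFieldNormedType.Exports.
Local Open Scope classical_set_scope.
Local Open Scope ring_scope.
(* [coord] of mathcomp's vector.v would otherwise shadow the field of [metric_atlas]. *)
Import Pilot.Defs.

(** * Topology and smooth functions *)

Section Topology.

(** The functions are chosen so that the logarithmic derivatives of [f], [h], [phi] with respect to
    xi are constant multiples of 1/s, while (1/s)' = - A / s^2. Every second order expression is
    then a constant times 1/s^2, and the differential equations become algebraic ones for [A] and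
    [N]. All exponents are quotients by [A], so [A] must be shown to be nonzero first; its strict
    sign also decides the side of the hyperplane. Derivatives are taken of [in_coord], which is 0
    off the image of a chart. A closed form, for instance of a Christoffel symbol, is known only on
    the chart domain and may be differentiated because that image is open. Each such form is
    separated: a constant times a power of s times a function on [F]. One product rule in separated
    variables is then enough. Derivatives of powers are written as a multiple of 1/s times the power
    itself, so most identities need no arithmetic of exponents and are left to [field]. *)

Lemma hausdorff_prod (T U : topologicalType) :
  hausdorff_space T -> hausdorff_space U -> hausdorff_space (T * U)%type.
Proof.
move=> hT hU [x1 y1] [x2 y2] clu; congr pair.
  apply: hT => A B nA nB.
  have [||[p q] [/= [? _] [? _]]] := clu (A `*` setT) (B `*` setT).
  - by exists (A, setT) => //; split=> //; apply: filterT.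
  - by exists (B, setT) => //; split=> //; apply: filterT.
  by exists p.
apply: hU => A B nA nB.
have [||[p q] [/= [_ ?] [_ ?]]] := clu (setT `*` A) (setT `*` B).
- by exists (setT, A) => //; split=> //; apply: filterT.
- by exists (setT, B) => //; split=> //; apply: filterT.
by exists q.
Qed.

Lemma open_setX (T U : topologicalType) (A : set T) (B : set U) :
  open A -> open B -> open (A `*` B).
Proof.
move=> oA oB; rewrite openE => -[x y] [/= Ax By]; exists (A, B) => //.
by split; exact: open_nbhs_nbhs.
Qed.

Lemma second_countable_prod (T U : topologicalType) :
  @second_countable T -> @second_countable U ->
  @second_countable (T * U)%type.
Proof.
move=> [B cB [oB bB]] [C cC [oC bC]].
exists ((fun p => p.1 `*` p.2) @` (B `*` C)).
  apply: (card_le_trans (card_image_le _ _)).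
  exact: countableX.
split=> [_ [[V W] [/= BV CW] <-]|[x y] P [[V W] /= [nV nW] VWP]].
  by apply: open_setX; [exact: oB|exact: oC].
have [V' [/= BV' V'x] V'V] := bB x V nV.
have [W' [/= CW' W'y] W'W] := bC y W nW.
exists (V' `*` W'); first by split=> //; exists (V', W').
by apply: subset_trans VWP => -[p q] [/= ? ?]; split; [exact: V'V|exact: W'W].
Qed.

(** Needed for the base: the type of points of [D] carries the initial topology of its inclusion
    into the space of row vectors. *)
Lemma second_countable_initial (S : choiceType) (T : topologicalType)
    (f : S -> T) :
  @second_countable T -> @second_countable (initial_topology f).
Proof.
move=> [B cB [oB bB]]; exists ((fun V => f @^-1` V) @` B).
  exact: (card_le_trans (card_image_le _ _)).
split=> [_ [V BV <-]|x P [_ [[V oV <-] Vx VP]]].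
  by exists V => //; exact: oB.
have [V' [BV' V'x] V'V] : filter_from [set U | B U /\ U (f x)] id V.
  by apply: bB; exact: open_nbhs_nbhs.
exists (f @^-1` V'); first by split=> //; exists V'.
by move=> z /V'V; exact: VP.
Qed.

Lemma hausdorff_initial (S : choiceType) (T : topologicalType) (f : S -> T) :
  injective f -> hausdorff_space T -> hausdorff_space (initial_topology f).
Proof.
move=> injf hT x y clu; apply: injf; apply: hT => A B nA nB.
have [||z [/= ? ?]] := clu (f @^-1` A) (f @^-1` B).
- exact: (@initial_continuous _ _ f x).
- exact: (@initial_continuous _ _ f y).
by exists (f z).
Qed.

(** The open boxes with rational corners form a countable base, since neighbourhoods of a matrix are
    given entry by entry. *)
Lemma second_countable_mx (R : realType) (m n : nat) :
  @second_countable 'M[R]_(m, n).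
Proof.
pose box (p : 'M[rat]_(m, n) * 'M[rat]_(m, n)) : set 'M[R]_(m, n) :=
  [set M | forall i j, ratr (p.1 i j) < M i j < ratr (p.2 i j)].
exists (box @` setT).
  by apply: (card_le_trans (card_image_le _ _)); exact: countableP.
split=> [_ [p _ <-]|M P [Q nQ QP]].
  rewrite openE => M pM; exists (fun i j => [set x | ratr (p.1 i j) < x < ratr (p.2 i j)]).
    move=> i j; have Mij : M i j \in `]ratr (p.1 i j), ratr (p.2 i j)[.
      by rewrite in_itv /=; exact: pM.
    by apply: filterS (near_in_itvoo Mij) => x; rewrite /= in_itv.
  by move=> N /= pN i j; exact: pN.
have /choice[q qP] (ij : 'I_m * 'I_n) : exists q : rat * rat,
    ratr q.1 < M ij.1 ij.2 < ratr q.2 /\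
    [set x | ratr q.1 < x < ratr q.2] `<=` Q ij.1 ij.2.
  have /nbhs_ballP[e /= e0 eQ] := nQ ij.1 ij.2.
  have [a] := @rat_in_itvoo R (M ij.1 ij.2 - e) (M ij.1 ij.2) ltac:(lra).
  have [b] := @rat_in_itvoo R (M ij.1 ij.2) (M ij.1 ij.2 + e) ltac:(lra).
  rewrite !in_itv /= => /andP[b1 b2] /andP[a1 a2].
  exists (a, b); split; first by rewrite /= a2.
  move=> x /= /andP[ax xb]; apply: eQ; rewrite /ball /= ltr_norml.
  by apply/andP; split; lra.
exists (box (\matrix_(i, j) (q (i, j)).1, \matrix_(i, j) (q (i, j)).2)).
  by split; [eexists|move=> i j; rewrite !mxE; exact: (qP (i, j)).1].
move=> N boxN; apply: QP => i j; apply: (qP (i, j)).2.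
by have := boxN i j; rewrite !mxE.
Qed.

End Topology.

(** * Functions of class C^N: local nature, sums, products, linear substitutions *)

Section ClassC.
Variable R : realType.

Section OneSpace.
Variable d : nat.
Implicit Types (U V : set 'rV[R]_d) (f g : 'rV[R]_d -> R) (N : nat).

(** As [U] is open, equality on [U] is equality near each of its points, which is what limits and
    derivatives require. *)
Lemma class_C_eq N U f g : open U -> (forall x, U x -> f x = g x) ->
  class_C N U f -> class_C N U g.
Proof.
move=> oU; elim: N f g => [|N IHN] f g fg [cf df].
all: have near_fg x : U x -> {near x, f =1 g}.
all: try by move=> Ux; apply: filterS fg _; exact: open_nbhs_nbhs.
all: have cg x : U x -> {for x, continuous g}.
all: try by move=> Ux; apply: cvg_trans (near_eq_cvg (near_fg x Ux)) _;
       rewrite -fg//; exact: cf.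
  by [].
split=> // k; have [dfk Cfk] := df k; split=> [x Ux|].
  by apply: (near_eq_derivable (near_fg x Ux)); exact: dfk.
apply: IHN Cfk => x Ux; exact: near_eq_derive (near_fg x Ux).
Qed.

Lemma class_C_subset N U V f : V `<=` U -> class_C N U f -> class_C N V f.
Proof.
move=> VU; elim: N f => [|N IHN] f [cf df].
all: split=> [x /VU|//]; first exact: cf.
move=> k; have [dfk Cfk] := df k; split; last exact: IHN.
by move=> x /VU; exact: dfk.
Qed.

Lemma class_C_le N U f : class_C N.+1 U f -> class_C N U f.
Proof.
elim: N f => [|N IHN] f [cf df]; first by [].
by split=> // k; have [dfk Cfk] := df k; split; last exact: IHN.
Qed.

Lemma class_C_cst N U (a : R) : class_C N U (cst a).
Proof.
elim: N a => [|N IHN] a.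
all: split=> [x _|//]; first exact: cst_continuous.
move=> k.
split=> [x _|]; first exact: derivable_cst.
suff -> : 'D_(delta_mx 0 k) (cst a : 'rV[R]_d -> R) = cst 0 by exact: IHN.
by apply/funext => x; exact: derive_cst.
Qed.

Lemma class_C_add N U f g : open U -> class_C N U f -> class_C N U g ->
  class_C N U (f + g).
Proof.
move=> oU; elim: N f g => [|N IHN] f g [cf df] [cg dg].
  by split=> // x Ux; exact: (continuousD (cf x Ux) (cg x Ux)).
split=> [x Ux|k]; first by exact: (continuousD (cf x Ux) (cg x Ux)).
have [dfk Cfk] := df k; have [dgk Cgk] := dg k; split=> [x Ux|].
  by apply: derivableD; [exact: dfk|exact: dgk].
apply: (class_C_eq oU) (IHN _ _ Cfk Cgk) => x Ux.
by rewrite deriveD//; [exact: dfk|exact: dgk].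
Qed.

(** The product rule pairs a derivative of one factor with the other factor itself, whose class has
    to be lowered by one before the induction hypothesis applies. *)
Lemma class_C_mul N U f g : open U -> class_C N U f -> class_C N U g ->
  class_C N U (f * g).
Proof.
move=> oU; elim: N f g => [|N IHN] f g Cf Cg; have [cf df] := Cf; have [cg dg] := Cg.
  by split=> // x Ux; exact: (continuousM (cf x Ux) (cg x Ux)).
split=> [x Ux|k]; first by exact: (continuousM (cf x Ux) (cg x Ux)).
have [dfk Cfk] := df k; have [dgk Cgk] := dg k; split=> [x Ux|].
  by apply: derivableM; [exact: dfk|exact: dgk].
have C1 := IHN _ _ (class_C_le Cf) Cgk.
have C2 := IHN _ _ (class_C_le Cg) Cfk.
apply: (class_C_eq oU) (class_C_add oU C1 C2) => x Ux.
by rewrite deriveM//; [exact: dfk|exact: dgk].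
Qed.

End OneSpace.

(** The two difference quotients are literally the same function of the step, so no
    differentiability of [f] is assumed. *)
Lemma derivable_comp_linear (V W : normedModType R) (L : {linear V -> W})
    (f : W -> R) x v : derivable (f \o L) x v = derivable f (L x) (L v).
Proof.
have LE (h : R) : L (h *: v + x) = h *: L v + L x by rewrite linearP.
by rewrite /derivable; under eq_fun do rewrite /= LE.
Qed.

Lemma derive_comp_linear (V W : normedModType R) (L : {linear V -> W})
    (f : W -> R) x v : 'D_v (f \o L) x = 'D_(L v) f (L x).
Proof.
have LE (h : R) : L (h *: v + x) = h *: L v + L x by rewrite linearP.
by rewrite /derive; under eq_fun do rewrite /= LE.
Qed.

(** [class_C] speaks of derivatives along basis vectors only, hence the condition on the images of
    basis vectors. The two projections of a product chart satisfy it. *)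
Lemma class_C_comp_linear N (d d' : nat) (L : {linear 'rV[R]_d -> 'rV[R]_d'})
    (U : set 'rV[R]_d') (f : 'rV[R]_d' -> R) :
  continuous L ->
  (forall k, L (delta_mx 0 k) = 0 \/
             exists k', L (delta_mx 0 k) = delta_mx 0 k') ->
  class_C N U f -> class_C N (L @^-1` U) (f \o L).
Proof.
move=> cL Ldelta; elim: N f => [|N IHN] f [cf df].
all: split=> [x Ux|//]; first by apply: continuous_comp; [exact: cL|exact: cf].
move=> k.
have DL : 'D_(delta_mx 0 k) (f \o L) = 'D_(L (delta_mx 0 k)) f \o L.
  by apply/funext => x; exact: derive_comp_linear.
rewrite DL; have [L0|[k' Lk]] := Ldelta k; split.
- by move=> x _; rewrite derivable_comp_linear L0; exact: derivable0.
- rewrite L0; suff -> : 'D_0 f \o L = cst 0 by exact: class_C_cst.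
  by apply/funext => x; exact: derive0.
- by move=> x Ux; rewrite derivable_comp_linear Lk; exact: (df k').1.
by rewrite Lk; apply: IHN; exact: (df k').2.
Qed.

End ClassC.

(** * Index of a symmetric matrix *)

Section Index.
Variable R : realType.

Lemma has_index_ex (d : nat) (G : 'M[R]_d) : exists nu, has_index G nu.
Proof.
pose P nu := `[< exists2 W : 'M[R]_d, negative_definite_on G W & \rank W = nu >].
have P0 : exists nu, P nu.
  exists 0%N; apply/asboolP; exists 0; last by rewrite mxrank0.
  by move=> v; rewrite submx0 => /eqP ->; rewrite eqxx.
have Pd nu : P nu -> (nu <= d)%N by move=> /asboolP[W _ <-]; exact: rank_leq_row.
have [nu /asboolP Pnu nu_max] := ex_maxnP P0 Pd.
by exists nu; split=> // W nW; apply: nu_max; apply/asboolP; exists W.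
Qed.

Lemma has_index_scale (d : nat) (G : 'M[R]_d) nu (a : R) : 0 < a ->
  has_index G nu -> has_index (a *: G) nu.
Proof.
move=> a0; suff negZ W : negative_definite_on (a *: G) W <-> negative_definite_on G W.
  by move=> [[W /negZ nW rW] max]; split; [exists W|move=> ? /negZ; exact: max].
have aE (B : 'M[R]_1) : (a *: B) 0 0 = a * B 0 0 by rewrite mxE.
split=> nW v vW v0; have := nW v vW v0;
  by rewrite -scalemxAr -scalemxAl aE pmulr_rlt0.
Qed.

(** [P] is the orthogonal complement of a maximal [W] with respect to [G], cut out by \rank W
    equations. A vector of [P] with negative value could be adjoined to [W], the cross terms being
    zero, against maximality. *)
Lemma has_index_nonneg (d : nat) (G : 'M[R]_d) nu : G^T = G ->
  has_index G nu ->
  exists2 P : 'M[R]_d, (d <= \rank P + nu)%N &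
    forall v : 'rV[R]_d, (v <= P)%MS -> 0 <= (v *m G *m v^T) 0 0.
Proof.
move=> symG [[W nW rW] max]; exists (kermx (G *m W^T)).
  rewrite mxrank_ker -rW addnC -leq_subLR leq_sub2l//.
  by rewrite (leq_trans (mxrankM_maxr _ _))// mxrank_tr.
move=> v /sub_kermxP; rewrite mulmxA => vGW; rewrite leNgt; apply/negP => qv.
have vW (D : 'rV_d) : v *m G *m (D *m W)^T = 0.
  by rewrite trmx_mul mulmxA vGW mul0mx.
have nWv : negative_definite_on G (W + v)%MS.
  move=> u /sub_addsmxP[[D1 D2] /= ->]; set w := D1 *m W.
  have wW : (w <= W)%MS by exact: submxMl.
  have vw : v *m G *m w^T = 0 by exact: vW.
  clearbody w.
  have [a ->] : exists a, D2 = a%:M by exists (D2 0 0); rewrite -mx11_scalar.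
  rewrite mul_scalar_mx => u0.
  have -> : ((w + a *: v) *m G *m (w + a *: v)^T) 0 0 =
            (w *m G *m w^T) 0 0 + a ^+ 2 * (v *m G *m v^T) 0 0.
    have wv : w *m G *m v^T = 0.
      by apply: trmx_inj; rewrite !trmx_mul symG trmxK trmx0 mulmxA.
    rewrite linearD/= linearZ/= !mulmxDl !mulmxDr -!scalemxAl -!scalemxAr vw wv.
    by rewrite !scaler0 addr0 add0r !mxE; congr (_ + _); rewrite expr2 mulrA.
  have [w0|w0] := eqVneq w 0.
    rewrite w0 !mul0mx mxE add0r nmulr_llt0// lt_neqAle sqr_ge0 andbT eq_sym.
    by rewrite sqrf_eq0; apply: contraNneq u0 => ->; rewrite w0 scale0r addr0.
  rewrite ltr_nwDl//; first exact: nW.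
  by rewrite mulr_ge0_le0 ?sqr_ge0// ltW.
(* The rank really grows: a vector [v] lying in [W] would be orthogonal to itself, so its value
   would be 0 and not negative. *)
have := max _ nWv; rewrite leqNgt -rW => /negP; apply; apply: rank_ltmx.
rewrite ltmxE addsmxSl /=; apply/negP => /(submx_trans (addsmxSr _ _)).
by move=> /submxP[D vD]; move: qv; rewrite {2}vD vW mxE ltxx.
Qed.

(** A negative definite [W'] meets [P] only in 0, so \rank W' + \rank P is at most [d]. This
    certificate for the index passes to block sums, unlike maximality itself. *)
Lemma has_index_of_nonneg (d : nat) (G W P : 'M[R]_d) nu :
  negative_definite_on G W -> \rank W = nu -> (d <= \rank P + nu)%N ->
  (forall v : 'rV[R]_d, (v <= P)%MS -> 0 <= (v *m G *m v^T) 0 0) ->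
  has_index G nu.
Proof.
move=> nW rW rP nnP; split; first by exists W.
move=> W' nW'; have cap0 : \rank (W' :&: P)%MS = 0%N.
  apply/eqP; rewrite mxrank_eq0; apply: contraT => /rowV0Pn[v].
  rewrite sub_capmx => /andP[vW' vP] v0.
  by have := nnP v vP; rewrite leNgt nW'.
have := mxrank_sum_cap W' P; rewrite cap0 addn0 => rW'P.
rewrite -(leq_add2r (\rank P)) -rW'P (leq_trans (rank_leq_col _))//.
by rewrite addnC.
Qed.

Lemma quad_block_mx (m n : nat) (G : 'M[R]_m) (H : 'M[R]_n)
    (u : 'rV_m) (v : 'rV_n) :
  (row_mx u v *m block_mx G 0 0 H *m (row_mx u v)^T) 0 0 =
  (u *m G *m u^T) 0 0 + (v *m H *m v^T) 0 0 :> R.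
Proof.
by rewrite mul_row_block !mulmx0 addr0 add0r tr_row_mx mul_row_col mxE.
Qed.

Lemma has_index_block (m n : nat) (G : 'M[R]_m) (H : 'M[R]_n) mu nu :
  G^T = G -> H^T = H -> has_index G mu -> has_index H nu ->
  has_index (block_mx G 0 0 H) (mu + nu).
Proof.
move=> symG symH iG iH.
have [P rP nnP] := has_index_nonneg symG iG.
have [Q rQ nnQ] := has_index_nonneg symH iH.
have [[[V nV rV] _] [[W nW rW] _]] := (iG, iH).
have sub_block (A : 'M[R]_m) (B : 'M[R]_n) w : (w <= block_mx A 0 0 B)%MS ->
    exists u v, [/\ w = row_mx u v, (u <= A)%MS & (v <= B)%MS].
  move=> /submxP[D ->]; rewrite -[D]hsubmxK mul_row_block !mulmx0 addr0 add0r.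
  by do 2!eexists; split; first reflexivity; exact: submxMl.
apply: (@has_index_of_nonneg _ _ (block_mx V 0 0 W) (block_mx P 0 0 Q)).
- move=> _ /sub_block[u [v [-> uV vW]]]; rewrite quad_block_mx => uv0.
  have [u0|u0] := eqVneq u 0; have [v0|v0] := eqVneq v 0.
  + by move: uv0; rewrite u0 v0 row_mx0 eqxx.
  + by rewrite u0 !mul0mx mxE add0r nW.
  + by rewrite v0 !mul0mx [X in _ + X]mxE addr0 nV.
  + by rewrite -[ltRHS]addr0 ltrD ?nV ?nW.
- by rewrite rank_diag_block_mx rV rW.
- by rewrite rank_diag_block_mx addnACA leq_add.
by move=> _ /sub_block[u [v [-> uP vQ]]]; rewrite quad_block_mx addr_ge0 ?nnP ?nnQ.
Qed.

End Index.

(** * Warped products *)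

Section Coordinates.
Context {R : realType} {d : nat} {M : topologicalType}.
Variable A : metric_atlas R d M.
Implicit Types (c : chart A) (p : M) (F G : M -> R).

Lemma eq_in_coord c F G : (forall p, dom c p -> F p = G p) ->
  in_coord c F = in_coord c G.
Proof.
move=> FG; apply/funext => x; congr xget; apply/seteqP.
by split=> _ [p [cp xp] <-]; exists p => //; rewrite FG.
Qed.

(** The tool for differentiating a quantity through a closed form that is valid only on the chart
    domain. *)
Lemma eq_partial c (k : 'I_d) F G p : (forall p, dom c p -> F p = G p) ->
  partial c k F p = partial c k G p.
Proof. by move=> FG; rewrite /partial (eq_in_coord FG). Qed.

Lemma in_coordE c F p : is_chart c -> dom c p -> in_coord c F (coord c p) = F p.
Proof.
move=> [_ injc _ _] cp; apply: xget_subset1; first by exists p.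
move=> _ _ [q [cq qp] <-] [q' [cq' q'p] <-]; congr F; apply: injc.
- by rewrite inE.
- by rewrite inE.
by rewrite qp q'p.
Qed.

(** The default value of [in_coord] is 0, so the coordinate expression is constant on the whole
    space and no condition on [c] or [p] is needed. *)
Lemma partial0 c (k : 'I_d) p : partial c k (fun=> 0) p = 0.
Proof.
have -> : partial c k (fun=> 0) p = 'D_(delta_mx 0 k) (cst (0 : R)) (coord c p).
  congr derive; apply/funext => x; rewrite /in_coord.
  by case: xgetP => // y _ [].
exact: derive_cst.
Qed.

Lemma open_coord c : is_chart c -> open (coord c @` dom c).
Proof. by move=> [odom _ _]; apply. Qed.

End Coordinates.

Section WarpedProduct.
Context {R : realType} {n m : nat} {B F : topologicalType}.
Variables (gB : metric_atlas R n B) (f : B -> R) (gF : metric_atlas R m F).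

Local Notation W := (warped_product gB f gF).

Local Notation lsub := (lsubmx : 'rV[R]_(n + m) -> 'rV[R]_n).
Local Notation rsub := (rsubmx : 'rV[R]_(n + m) -> 'rV[R]_m).

Lemma lsubmx_delta (k : 'I_(n + m)) : lsub (delta_mx 0 k) =
  match fintype.split k with inl i => delta_mx 0 i | inr _ => 0 end.
Proof.
apply/rowP => j; rewrite mxE; case: splitP => [i|i] ki; rewrite !mxE/=.
  by congr (nat_of_bool _)%:R; rewrite -(inj_eq val_inj)/= ki.
by rewrite -(inj_eq val_inj)/= ki ltn_eqF// (leq_trans (ltn_ord j))// leq_addr.
Qed.

Lemma rsubmx_delta (k : 'I_(n + m)) : rsub (delta_mx 0 k) =
  match fintype.split k with inl _ => 0 | inr i => delta_mx 0 i end.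
Proof.
apply/rowP => j; rewrite mxE; case: splitP => [i|i] ki; rewrite !mxE/=.
  by rewrite -(inj_eq val_inj)/= ki gtn_eqF// (leq_trans (ltn_ord i))// leq_addr.
by congr (nat_of_bool _)%:R; rewrite -(inj_eq val_inj)/= ki eqn_add2l.
Qed.

Lemma derive_lsubmx (g : 'rV[R]_n -> R) x v :
  'D_v (g \o lsub) x = 'D_(lsub v) g (lsub x).
Proof. exact: derive_comp_linear. Qed.

Lemma derive_rsubmx (g : 'rV[R]_m -> R) x v :
  'D_v (g \o rsub) x = 'D_(rsub v) g (rsub x).
Proof. exact: derive_comp_linear. Qed.

Lemma derivable_lsubmx (g : 'rV[R]_n -> R) x v :
  derivable (g \o lsub) x v = derivable g (lsub x) (lsub v).
Proof. exact: derivable_comp_linear. Qed.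

Lemma derivable_rsubmx (g : 'rV[R]_m -> R) x v :
  derivable (g \o rsub) x v = derivable g (rsub x) (rsub v).
Proof. exact: derivable_comp_linear. Qed.

Lemma coord_warped_image (c1 : chart gB) (c2 : chart gF) A1 A2 :
  @coord _ _ _ W (c1, c2) @` (A1 `*` A2) =
  (lsub @^-1` (coord c1 @` A1)) `&` (rsub @^-1` (coord c2 @` A2)).
Proof.
apply/seteqP; split=> [_ [[p q] [/= Ap Aq] <-]|x [[p Ap px] [q Aq qx]]].
  by split; rewrite /= ?row_mxKl ?row_mxKr; [exists p|exists q].
by exists (p, q) => //=; rewrite px qx hsubmxK.
Qed.

Lemma is_chart_warped (c1 : chart gB) (c2 : chart gF) :
  is_chart c1 -> is_chart c2 -> @is_chart _ _ _ W (c1, c2).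
Proof.
move=> [dom1 i1 k1 h1] [dom2 i2 k2 h2]; split=> /=.
- exact: open_setX.
- move=> [p q] [p' q']; rewrite !inE => -[/= dp dq] [/= dp' dq'].
  by move=> /eq_row_mx[pp' qq']; congr pair; [apply: i1|apply: i2]; rewrite ?inE.
(* [Q] prescribes a neighbourhood for each entry; its left and right entries give one neighbourhood
   for each factor. *)
- move=> [p q] [/= dp dq] V [Q nQ QV].
  pose S1 : set 'rV[R]_n := [set N | forall j, Q 0 (lshift m j) (N 0 j)].
  pose S2 : set 'rV[R]_m := [set N | forall j, Q 0 (rshift n j) (N 0 j)].
  have n1 : nbhs (coord c1 p) S1.
    exists (fun i j => Q 0 (lshift m j)); last by move=> N QN j; exact: QN.
    by move=> i j; have := nQ 0 (lshift m j); rewrite row_mxEl ord1.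
  have n2 : nbhs (coord c2 q) S2.
    exists (fun i j => Q 0 (rshift n j)); last by move=> N QN j; exact: QN.
    by move=> i j; have := nQ 0 (rshift n j); rewrite row_mxEr ord1.
  exists (coord c1 @^-1` S1, coord c2 @^-1` S2).
    by split; [exact: k1 n1|exact: k2 n2].
  move=> [p' q'] [/= Qp Qq]; apply: QV => i j; rewrite ord1.
  by case: (split_ordP j) => k ->; rewrite ?row_mxEl ?row_mxEr.
move=> U oU Udom; rewrite openE => _ [[p q] Upq <-] /=.
have [[V1 V2] [/= nV1 nV2] VU] : nbhs (p, q) U by exact: open_nbhs_nbhs.
have [dp dq] := Udom _ Upq.
(* Open and inside the chart domains, so that the factor charts map these sets to open sets. *)
pose V1' := V1° `&` dom c1; pose V2' := V2° `&` dom c2.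
have oV1 : open V1' by apply: openI => //; exact: open_interior.
have oV2 : open V2' by apply: openI => //; exact: open_interior.
have : nbhs (row_mx (coord c1 p) (coord c2 q))
    ((lsub @^-1` (coord c1 @` V1')) `&` (rsub @^-1` (coord c2 @` V2'))).
  apply: open_nbhs_nbhs; split.
    apply: openI; apply: open_comp.
    - by move=> x _; exact: continuous_lsubmx.
    - by apply: h1 => // x [].
    - by move=> x _; exact: continuous_rsubmx.
    - by apply: h2 => // x [].
  by split; rewrite /= ?row_mxKl ?row_mxKr; [exists p|exists q].
apply: filterS; rewrite -coord_warped_image; apply: image_subset.
by move=> [x y] [[/interior_subset V1x _] [/interior_subset V2y _]]; exact: VU.
Qed.

Section Charts.
Variables (c1 : chart gB) (c2 : chart gF).
Hypotheses (hc1 : is_chart c1) (hc2 : is_chart c2).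
Let c : chart W := (c1, c2).
Let hc : is_chart c := is_chart_warped hc1 hc2.
Let coordE p : coord c p = row_mx (coord c1 p.1) (coord c2 p.2).
Proof. by []. Qed.

Lemma open_warped_image A1 A2 : open A1 -> open A2 ->
  A1 `<=` dom c1 -> A2 `<=` dom c2 -> open (coord c @` (A1 `*` A2)).
Proof.
move=> oA1 oA2 A1c A2c; have [_ _ _] := hc; apply; first exact: open_setX.
by move=> [p q] [/= /A1c ? /A2c ?].
Qed.

(** Restricted to the chart image because elsewhere the left side is 0, while the right side sees
    only the base coordinates and may differ. *)
Lemma in_coord_fst (u : B -> R) x : (coord c @` dom c) x ->
  in_coord c (fun p => u p.1) x = (in_coord c1 u \o lsub) x.
Proof.
move=> [p dp <-]; have [d1 d2] := dp.
by rewrite (in_coordE _ hc)// /comp coordE row_mxKl (in_coordE _ hc1).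
Qed.

Lemma in_coord_snd (v : F -> R) x : (coord c @` dom c) x ->
  in_coord c (fun p => v p.2) x = (in_coord c2 v \o rsub) x.
Proof.
move=> [p dp <-]; have [d1 d2] := dp.
by rewrite (in_coordE _ hc)// /comp coordE row_mxKr (in_coordE _ hc2).
Qed.

Lemma in_coord_warpedM (u : B -> R) (v : F -> R) x : (coord c @` dom c) x ->
  in_coord c (fun p => u p.1 * v p.2) x =
  ((in_coord c1 u \o lsub) * (in_coord c2 v \o rsub)) x.
Proof.
move=> [p dp <-]; have [d1 d2] := dp.
rewrite (in_coordE _ hc)// coordE; rewrite [RHS]/(in_coord c1 u _ * in_coord c2 v _).
by rewrite row_mxKl row_mxKr (in_coordE _ hc1)// (in_coordE _ hc2).
Qed.

Lemma class_C_lsubmx N U (g : 'rV[R]_n -> R) :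
  class_C N U g -> class_C N (lsub @^-1` U) (g \o lsub).
Proof.
apply: class_C_comp_linear; first exact: continuous_lsubmx.
move=> k /=; rewrite lsubmx_delta; case: (fintype.split k) => i; [right|left] => //.
by exists i.
Qed.

Lemma class_C_rsubmx N U (g : 'rV[R]_m -> R) :
  class_C N U g -> class_C N (rsub @^-1` U) (g \o rsub).
Proof.
apply: class_C_comp_linear; first exact: continuous_rsubmx.
move=> k /=; rewrite rsubmx_delta; case: (fintype.split k) => i; [left|right] => //.
by exists i.
Qed.

Section Smooth.
Variables (A1 : set B) (A2 : set F).
Hypotheses (oA1 : open A1) (oA2 : open A2).
Hypotheses (A1c : A1 `<=` dom c1) (A2c : A2 `<=` dom c2).

Let A12c : coord c @` (A1 `*` A2) `<=` coord c @` dom c.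
Proof. by apply: image_subset => -[p q] [/= /A1c ? /A2c ?]. Qed.

Let oA := open_warped_image oA1 oA2 A1c A2c.

(** General open [A1] and [A2] are allowed because coordinate changes are smooth only over the
    overlap of two chart domains. *)
Lemma smooth_on_fst (u : B -> R) : smooth_on (coord c1 @` A1) (in_coord c1 u) ->
  smooth_on (coord c @` (A1 `*` A2)) (in_coord c (fun p => u p.1)).
Proof.
move=> su N; apply: (@class_C_eq _ _ N _ (in_coord c1 u \o lsub)) => //.
  by move=> x /A12c xc; rewrite in_coord_fst.
apply: class_C_subset (class_C_lsubmx (su N)).
by rewrite coord_warped_image => x [].
Qed.

Lemma smooth_on_snd (v : F -> R) : smooth_on (coord c2 @` A2) (in_coord c2 v) ->
  smooth_on (coord c @` (A1 `*` A2)) (in_coord c (fun p => v p.2)).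
Proof.
move=> sv N; apply: (@class_C_eq _ _ N _ (in_coord c2 v \o rsub)) => //.
  by move=> x /A12c xc; rewrite in_coord_snd.
apply: class_C_subset (class_C_rsubmx (sv N)).
by rewrite coord_warped_image => x [].
Qed.

Lemma smooth_on_warpedM (u : B -> R) (v : F -> R) :
  smooth_on (coord c1 @` A1) (in_coord c1 u) ->
  smooth_on (coord c2 @` A2) (in_coord c2 v) ->
  smooth_on (coord c @` (A1 `*` A2)) (in_coord c (fun p => u p.1 * v p.2)).
Proof.
move=> su sv N; apply: (@class_C_eq _ _ N _
    ((in_coord c1 u \o lsub) * (in_coord c2 v \o rsub))) => //.
  by move=> x /A12c xc; rewrite in_coord_warpedM.
have AE := coord_warped_image c1 c2 A1 A2.
apply: class_C_mul => //.
  by apply: class_C_subset (class_C_lsubmx (su N)); rewrite AE => x [].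
by apply: class_C_subset (class_C_rsubmx (sv N)); rewrite AE => x [].
Qed.

End Smooth.

Section Partial.
Variables (p : B * F).
Hypotheses (dp : dom c p).

Let near_image : \forall x \near coord c p, (coord c @` dom c) x.
Proof.
by apply: open_nbhs_nbhs; split; [exact: (open_coord hc)|exists p].
Qed.

Lemma partial_fst k (u : B -> R) : partial c k (fun p => u p.1) p =
  match fintype.split k with inl i => partial c1 i u p.1 | inr _ => 0 end.
Proof.
rewrite /partial (@near_eq_derive _ _ _ _ (in_coord c1 u \o lsub)); last first.
  by apply: filterS near_image => x; exact: in_coord_fst.
rewrite derive_lsubmx lsubmx_delta coordE row_mxKl.
by case: (fintype.split k) => // i; rewrite derive0.
Qed.

Lemma partial_snd k (v : F -> R) : partial c k (fun p => v p.2) p =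
  match fintype.split k with inl _ => 0 | inr i => partial c2 i v p.2 end.
Proof.
rewrite /partial (@near_eq_derive _ _ _ _ (in_coord c2 v \o rsub)); last first.
  by apply: filterS near_image => x; exact: in_coord_snd.
rewrite derive_rsubmx rsubmx_delta coordE row_mxKr.
by case: (fintype.split k) => // i; rewrite derive0.
Qed.

Lemma partial_warpedM k (u : B -> R) (v : F -> R) :
  (forall i, derivable (in_coord c1 u) (coord c1 p.1) (delta_mx 0 i)) ->
  (forall i, derivable (in_coord c2 v) (coord c2 p.2) (delta_mx 0 i)) ->
  partial c k (fun p => u p.1 * v p.2) p =
  match fintype.split k with
  | inl i => partial c1 i u p.1 * v p.2
  | inr i => u p.1 * partial c2 i v p.2
  end.
Proof.
move=> du dv; rewrite /partial (@near_eq_derive _ _ _ _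
    ((in_coord c1 u \o lsub) * (in_coord c2 v \o rsub))); last first.
  by apply: filterS near_image => x; exact: in_coord_warpedM.
have [/= d1 d2] : dom c1 p.1 /\ dom c2 p.2 by [].
rewrite deriveM ?derivable_lsubmx ?derivable_rsubmx ?row_mxKl ?row_mxKr.
- rewrite derive_lsubmx derive_rsubmx lsubmx_delta rsubmx_delta /comp.
  rewrite row_mxKl row_mxKr.
  rewrite (in_coordE _ hc1)// (in_coordE _ hc2)//.
  case: (fintype.split k) => i; rewrite derive0 scaler0 ?add0r ?addr0//.
  by rewrite [LHS]mulrC.
- by rewrite lsubmx_delta; case: (fintype.split k) => // i; exact: derivable0.
- by rewrite rsubmx_delta; case: (fintype.split k) => // i; exact: derivable0.
Qed.

End Partial.
End Charts.

Lemma jacobian_warped (c1 c1' : chart gB) (c2 c2' : chart gF) p :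
  is_chart c1 -> is_chart c2 -> @dom _ _ _ W (c1, c2) p ->
  @jacobian_mx _ _ _ W (c1, c2) (c1', c2') p =
  block_mx (jacobian_mx c1 c1' p.1) 0 0 (jacobian_mx c2 c2' p.2).
Proof.
move=> h1 h2 dp; apply/matrixP => k l; rewrite mxE.
case: (split_ordP l) => j ->.
  under eq_fun do rewrite /= row_mxEl.
  rewrite (partial_fst h1 h2 dp k (fun q => coord c1' q 0 j)).
  by rewrite -[k in RHS]splitK; case: (fintype.split k) => i /=;
    rewrite ?block_mxEul ?block_mxEdl mxE.
under eq_fun do rewrite /= row_mxEr.
rewrite (partial_snd h1 h2 dp k (fun q => coord c2' q 0 j)).
by rewrite -[k in RHS]splitK; case: (fintype.split k) => i /=;
  rewrite ?block_mxEur ?block_mxEdr mxE.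
Qed.

Hypotheses (rB : semi_riemannian gB) (rF : semi_riemannian gF).
Hypotheses (f_smooth : smooth_function gB f) (f_neq0 : forall p, f p != 0).

Lemma semi_riemannian_warped : semi_riemannian W.
Proof.
have [[hausB scB] [chB covB] trB [symB smB tB] [nuB iB]] := rB.
have [[hausF scF] [chF covF] trF [symF smF tF] [nuF iF]] := rF.
split.
- by split; [exact: hausdorff_prod|exact: second_countable_prod].
- split=> [[c1 c2]|[p q]]; first exact: is_chart_warped.
  have [c1 d1] := covB p; have [c2 d2] := covF q.
  by exists (c1, c2).
- move=> [c1 c2] [c1' c2'] k.
  have -> : @dom _ _ _ W (c1, c2) `&` @dom _ _ _ W (c1', c2') =
            (dom c1 `&` dom c1') `*` (dom c2 `&` dom c2').
    by apply/seteqP; split=> [[p q] [[/= ? ?] [/= ? ?]]|[p q] [[/= ? ?] [/= ? ?]]].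
  have [od1 _ _ _] := chB c1; have [od1' _ _ _] := chB c1'.
  have [od2 _ _ _] := chF c2; have [od2' _ _ _] := chF c2'.
  case: (split_ordP k) => j ->.
    under [X in in_coord _ X]eq_fun do rewrite /= row_mxEl.
    by apply: (smooth_on_fst (chB c1) (chF c2) _ _ _ _ (trB c1 c1' j));
      [exact: openI|exact: openI|move=> ? []|move=> ? []].
  under [X in in_coord _ X]eq_fun do rewrite /= row_mxEr.
  by apply: (smooth_on_snd (chB c1) (chF c2) _ _ _ _ (trF c2 c2' j));
    [exact: openI|exact: openI|move=> ? []|move=> ? []].
- split.
  + move=> [c1 c2] [p q] [/= d1 d2].
    have [sB uB] := symB c1 p d1; have [sF uF] := symF c2 q d2.
    rewrite tr_block_mx !trmx0 sB linearZ/= sF; split=> //.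
    rewrite unitmxE det_lblock unitrM -!unitmxE uB unitmxZ ?uF//.
    by rewrite unitfE expf_neq0.
  + move=> [c1 c2] i j.
    have [od1 _ _ _] := chB c1; have [od2 _ _ _] := chF c2.
    have smooth0 : smooth_on (@coord _ _ _ W (c1, c2) @` (dom c1 `*` dom c2))
        (@in_coord _ _ _ W _ (c1, c2) (fun=> 0)).
      move=> N; apply: (@class_C_eq _ _ N _ (cst 0)); last exact: class_C_cst.
        exact: (open_warped_image (chB c1) (chF c2)).
      move=> _ [p dp <-]; rewrite (@in_coordE _ _ _ W)//.
      exact: (is_chart_warped (chB c1) (chF c2)).
    case: (split_ordP i) => i' ->; case: (split_ordP j) => j' ->.
    * under [X in in_coord _ X]eq_fun do rewrite /= block_mxEul.
      exact: (smooth_on_fst (chB c1) (chF c2) _ _ _ _ (smB c1 i' j')).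
    * by under [X in in_coord _ X]eq_fun do rewrite /= block_mxEur mxE.
    * by under [X in in_coord _ X]eq_fun do rewrite /= block_mxEdl mxE.
    * under [X in in_coord _ X]eq_fun do rewrite /= block_mxEdr mxE.
      apply: (@smooth_on_warpedM _ _ (chB c1) (chF c2) _ _ _ _ _ _ (fun p => f p ^+ 2)
        (fun q => metric c2 q i' j')) => //.
      (* The square of [f] is smooth as a product of two copies of [f]. *)
      move=> N; apply: (@class_C_eq _ _ N _ (in_coord c1 f * in_coord c1 f)).
      - exact: open_coord.
      - move=> _ [p dp <-]; rewrite [LHS]/(in_coord c1 f _ * in_coord c1 f _).
        by rewrite !in_coordE.
      - by apply: class_C_mul; [exact: open_coord|exact: f_smooth|exact: f_smooth].
  + move=> [c1 c2] [c1' c2'] [p q] dpq dpq'.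
    have [/= d1 d2] := dpq; have [/= d1' d2'] := dpq'.
    rewrite /= jacobian_warped// tr_block_mx !trmx0 !mulmx_block.
    rewrite !(mulmx0, mul0mx, addr0, add0r) -scalemxAr -scalemxAl.
    by rewrite -tB// -tF.
exists (nuB + nuF)%N => -[c1 c2] [p q] [/= d1 d2].
have [sB _] := symB c1 p d1; have [sF _] := symF c2 q d2.
apply: has_index_block => //; first by rewrite linearZ/= sF.
- exact: iB.
- by apply: has_index_scale (iF _ _ d2); rewrite exprn_even_gt0/= ?f_neq0.
Qed.

End WarpedProduct.

(** * Conformally flat domains *)

Section EuclideanDomain.
Context {R : realType} {n : nat}.
Variables (D : set 'rV[R]_n) (G : 'rV[R]_n -> 'M[R]_n).
Hypothesis openD : open D.

Local Notation E := (euclidean_domain D G).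

Lemma is_chart_euclidean (c : chart E) : is_chart c.
Proof.
split=> /=; first exact: openT.
- by move=> p q _ _; exact: val_inj.
- by move=> p _; exact: initial_continuous.
move=> U [V oV <-] _; suff -> : (set_val : D -> _) @` (set_val @^-1` V) = V `&` D.
  exact: openI.
apply/seteqP; split=> [_ [x Vx <-]|x [Vx Dx]].
  by split=> //; exact: set_valP.
by exists (exist _ x (mem_set Dx)).
Qed.

Lemma euclidean_image (c : chart E) : coord c @` dom c = D.
Proof.
apply/seteqP; split=> [_ [x _ <-]|x Dx]; first exact: set_valP.
by exists (exist _ x (mem_set Dx)).
Qed.

Lemma in_coord_euclidean (c : chart E) (g : 'rV[R]_n -> R) x : D x ->
  in_coord c (fun p : D => g (set_val p)) x = g x.
Proof.
move=> Dx; have [p _ <-] : (coord c @` dom c) x by rewrite euclidean_image.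
by rewrite in_coordE//; exact: is_chart_euclidean.
Qed.

Lemma near_in_coord_euclidean (c : chart E) (g : 'rV[R]_n -> R) x : D x ->
  \forall y \near x, in_coord c (fun p : D => g (set_val p)) y = g y.
Proof.
move=> Dx; have : nbhs x D by exact: open_nbhs_nbhs.
by apply: filterS => y; exact: in_coord_euclidean.
Qed.

Lemma partial_euclidean (c : chart E) k (g : 'rV[R]_n -> R) (p : D) :
  partial c k (fun p : D => g (set_val p)) p = 'D_(delta_mx 0 k) g (set_val p).
Proof. exact/near_eq_derive/near_in_coord_euclidean/set_valP. Qed.

Lemma smooth_on_euclidean (c : chart E) (g : 'rV[R]_n -> R) : smooth_on D g ->
  smooth_on (coord c @` dom c) (in_coord c (fun p : D => g (set_val p))).
Proof.
move=> sg N; rewrite euclidean_image; apply: class_C_eq (sg N) => // x Dx.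
by rewrite in_coord_euclidean.
Qed.

Lemma derive_coord (x : 'rV[R]_n) k (l : 'I_n) :
  'D_(delta_mx 0 k) (fun x : 'rV[R]_n => x 0 l) x = (k == l)%:R.
Proof.
have lin : linear (fun x : 'rV[R]_n => x 0 l) by move=> a u v; rewrite !mxE.
(* Viewed as a linear map followed by the identity of [R], the coordinate function is covered by
   [derive_comp_linear]. *)
pose L : {linear 'rV[R]_n -> R} :=
  HB.pack (fun x : 'rV[R]_n => x 0 l) (GRing.isLinear.Build _ _ _ _ _ lin).
by rewrite (derive_comp_linear L id) derive_id /= mxE eqxx /= eq_sym.
Qed.

Lemma smooth_coord (U : set 'rV[R]_n) (l : 'I_n) :
  smooth_on U (fun x : 'rV[R]_n => x 0 l).
Proof.
case=> [|N].
all: split=> [x _|//]; first exact: coord_continuous.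
move=> k; split=> [x _|]; first exact/diff_derivable/differentiable_coord.
suff -> : 'D_(delta_mx 0 k) (fun x : 'rV[R]_n => x 0 l) = cst (k == l)%:R.
  exact: class_C_cst.
by apply/funext => x; exact: derive_coord.
Qed.

End EuclideanDomain.

(** There is a single chart, so every Jacobian is the identity. The index is constant because a
    positive factor does not change the index of the fixed matrix [H]. *)
Lemma semi_riemannian_conformal (R : realType) (n : nat) (D : set 'rV[R]_n)
    (q : 'rV[R]_n -> R) (H : 'M[R]_n) :
  open D -> smooth_on D q -> (forall x, D x -> 0 < q x) ->
  H^T = H -> H \in unitmx ->
  semi_riemannian (euclidean_domain D (fun x => q x *: H)).
Proof.
move=> oD sq q0 symH unitH; pose E := euclidean_domain D (fun x => q x *: H).
have chE (c : chart E) : is_chart c by exact: is_chart_euclidean.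
have qp (p : D) : 0 < q (set_val p) by apply: q0; exact: set_valP.
split.
- split; first by apply: hausdorff_initial (@norm_hausdorff _ _); exact: val_inj.
  exact: second_countable_initial (second_countable_mx _ _ _).
- by split=> // p; exists tt.
- move=> c c' k; rewrite setIT.
  apply: (@smooth_on_euclidean _ _ _ _ oD c (fun x => x 0 k)).
  exact: smooth_coord.
- split.
  + move=> c p _ /=; rewrite linearZ/= symH; split=> //.
    by rewrite unitmxZ// unitfE gt_eqF.
  + move=> c i j; apply: (@smooth_on_euclidean _ _ _ _ _ _ (fun x => (q x *: H) i j)) => // N.
    rewrite (_ : (fun x => _) = q * cst (H i j)); last first.
      by apply/funext => x; rewrite mxE.
    by apply: class_C_mul => //; exact: class_C_cst.
  + move=> c c' p _ _ J; suff -> : J = 1%:M.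
      by rewrite mul1mx trmx1 mulmx1.
    apply/matrixP => k l; rewrite !mxE.
    by rewrite (@partial_euclidean _ _ _ _ _ _ _ (fun x => x 0 l))// derive_coord.
have [nu inu] := has_index_ex H.
by exists nu => c p _; apply: has_index_scale.
Qed.

Lemma powRB1 (R : realType) (x e : R) : 0 < x -> x `^ (e - 1) = x `^ e / x.
Proof.
by move=> x0; rewrite powRB ?powRr1 ?ltW//; rewrite (gt_eqF x0) implybT.
Qed.

Section PowerOfAffine.
Context {R : realType} {n : nat}.
Variables (alpha : 'I_n -> R) (A c : R).

Definition affine_form (x : 'rV[R]_n) : R := A * (\sum_i alpha i * x 0 i) + c.

Local Notation s := affine_form.

Lemma continuous_affine_form : continuous s.
Proof.
have csum : continuous (fun y : 'rV[R]_n => \sum_i alpha i * y 0 i).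
  apply: (@continuous_big _ _ +%R 0 xpredT _ _ _
    (fun i (y : 'rV[R]_n) => alpha i * y 0 i)) => [|i _ x].
    exact: add_continuous.
  exact: (cvgMl_tmp (@coord_continuous R 1 n 0 i x)).
by move=> x; exact: (cvgD (cvgMl_tmp (csum x)) (cvg_cst c)).
Qed.

Lemma open_affine_pos : open [set x | 0 < s x].
Proof.
apply: (@open_comp _ _ s [set t | 0 < t]); last exact: open_gt.
by move=> x _; exact: continuous_affine_form.
Qed.

(** The derivative is stated as a multiple of the function itself, so that after differentiation the
    same power of s reappears as a common factor. *)
Lemma is_derive_affine_powR (C e : R) k x : 0 < s x ->
  is_derive x (delta_mx 0 k) (fun x => C * s x `^ e)
    (e * A * alpha k / s x * (C * s x `^ e)).
Proof.
move=> sx.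
(* Along a coordinate line the form is affine in one real variable, where the derivative of a real
   power is available. *)
have lineE (h : R) : s (h *: delta_mx 0 k + x) = h * (A * alpha k) + s x.
  rewrite /s (eq_bigr (fun i => h * (alpha i * (i == k)%:R) + alpha i * x 0 i)); last first.
    by move=> i _; rewrite !mxE eqxx /=; ring.
  rewrite big_split /= -mulr_sumr (bigD1 k)//= eqxx mulr1 big1 ?addr0 => [|i /negPf ->].
    by ring.
  by rewrite mulr0.
have der : is_derive (0 : R) 1 (fun h : R => C * (h * (A * alpha k) + s x) `^ e)
    (e * A * alpha k / s x * (C * s x `^ e)).
  have spos : 0 < 0 * (A * alpha k) + s x by rewrite mul0r add0r.
  have dpow := is_derive1_powR e spos.
  have daff : is_derive (0 : R) 1 (fun h : R => h * (A * alpha k) + s x)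
      (A * alpha k).
    by apply: is_derive_eq; rewrite addr0 scaler0 add0r scaler1.
  have dcomp := @is_derive1_comp R (@powR R ^~ e)
    (fun h : R => h * (A * alpha k) + s x) 0 _ _ dpow daff.
  have -> : (fun h : R => C * (h * (A * alpha k) + s x) `^ e) =
      C \*o (@powR R ^~ e \o (fun h : R => h * (A * alpha k) + s x)) by [].
  apply: is_derive_eq; rewrite mul0r add0r.
  by rewrite powRB1// /GRing.scale/=; ring.
split.
  apply/derivable1P; under eq_fun do rewrite lineE.
  by case: der.
have <- := @derive_val _ _ _ _ _ _ _ der.
rewrite /derive; under eq_fun do rewrite /= lineE.
by under [in RHS]eq_fun do rewrite /= addr0 [_ *: 1]mulr1 mul0r add0r.
Qed.

(** The family of all such functions is closed under partial derivatives, hence the induction for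
    all [C] and [e] at once. *)
Lemma smooth_affine_powR (C e : R) :
  smooth_on [set x | 0 < s x] (fun x => C * s x `^ e).
Proof.
move=> N; elim: N C e => [|N IHN] C e.
all: split=> [x /= sx|//].
1,2: apply: continuousM; first exact: cst_continuous.
1,2: apply: (@continuous_comp _ _ _ s (@powR R ^~ e)); first exact: continuous_affine_form.
1,2: apply/differentiable_continuous/derivable1_diffP.
1,2: by have [] := is_derive1_powR e sx.
move=> k; split=> [x /= sx|]; first by have [] := is_derive_affine_powR C e k sx.
apply: class_C_eq (IHN (e * A * alpha k * C) (e - 1)); first exact: open_affine_pos.
move=> x /= sx; have /@derive_val -> := is_derive_affine_powR C e k sx.
by rewrite powRB1//; ring.
Qed.

End PowerOfAffine.

(** * Curvature *)

Lemma invmx_eq (K : comUnitRingType) (d : nat) (X Y : 'M[K]_d) :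
  X *m Y = 1%:M -> invmx X = Y.
Proof.
move=> XY; have [uX _] := mulmx1_unit XY.
by rewrite -[RHS]mul1mx -(mulVmx uX) -mulmxA XY mulmx1.
Qed.

(** The shape of the summand is the normal form to which the contractions below are brought. *)
Lemma sum_delta (K : pzRingType) (d : nat) (t : 'I_d) (a : K) (G : 'I_d -> K) :
  \sum_u a * (t == u)%:R * G u = a * G t.
Proof.
rewrite (bigD1 t)//= eqxx mulr1 big1 ?addr0// => u /negPf.
by rewrite eq_sym => ->; rewrite mulr0 mul0r.
Qed.

Lemma sumr_const_ord (K : pzRingType) (d : nat) (x : K) :
  \sum_(i < d) x = d%:R * x.
Proof. by rewrite sumr_const card_ord mulr_natl. Qed.

Section ConformalWarpedProduct.
Context {R : realType} {n m : nat} {F : topologicalType}.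
Variables (eps alpha : 'I_n -> R) (k A c Cq Cf : R).
Local Notation s := (affine_form alpha A c).
Local Notation D := [set x : 'rV[R]_n | 0 < s x].
Variables (q : 'rV[R]_n -> R) (f : D -> R) (gF : metric_atlas R m F).
Hypotheses (eps2 : forall i, eps i ^+ 2 = 1) (A0 : A != 0).
Hypotheses (Cq0 : Cq != 0) (Cf0 : Cf != 0).
Hypothesis qE : forall x, D x -> q x = Cq * s x `^ (2 * k / A).
Hypothesis f2E : forall p, f p ^+ 2 = Cf * s (set_val p) `^ (- 2 / A).
Hypothesis rF : semi_riemannian gF.

Local Notation E := (\sum_i eps i * alpha i ^+ 2).

(** For a metric e^(2u) eps with du = k alpha / s, the classical Christoffel symbols of a
    conformally flat metric are k/s times these coefficients. *)
Definition conf_coef (t i j : 'I_n) : R :=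
  alpha i * (t == j)%:R + alpha j * (t == i)%:R
  - eps t * eps i * alpha t * (i == j)%:R.

Lemma conf_coef_diag i j : conf_coef i i j = alpha j.
Proof. by rewrite /conf_coef eqxx mulr1 -[eps i * eps i]expr2 eps2; ring. Qed.

Lemma sum_conf_coef i j : \sum_t alpha t * conf_coef t i j =
  2 * (alpha i * alpha j) - eps i * (i == j)%:R * E.
Proof.
rewrite (eq_bigr (fun t => alpha i * (j == t)%:R * alpha t
    + alpha j * (i == t)%:R * alpha t
    - eps i * (i == j)%:R * (eps t * alpha t ^+ 2))).
  by rewrite sumrB big_split /= !sum_delta -mulr_sumr; ring.
by move=> t _; rewrite /conf_coef (eq_sym j) (eq_sym i t); ring.
Qed.

Lemma sum_conf_coef2 i j :
  \sum_t \sum_u conf_coef t i u * conf_coef u t j =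
  (n%:R + 2) * (alpha i * alpha j) - 2 * eps i * (i == j)%:R * E.
Proof.
rewrite (eq_bigr (fun t => alpha i * alpha j
    + 1 * (i == t)%:R * (2 * (alpha t * alpha j) - eps t * (t == j)%:R * E)
    - eps i * (i == j)%:R * (eps t * alpha t ^+ 2)
    - eps i * alpha j * (i == t)%:R * (eps t * alpha t)
    + eps i ^+ 2 * alpha i * (j == t)%:R * (eps t ^+ 2 * alpha t))); last first.
  (* Only the first factor is expanded: two of its terms select a value of the second factor, and
     the remaining one gives [sum_conf_coef]. *)
  move=> t _; rewrite (eq_bigr (fun u => alpha i * (t == u)%:R * conf_coef u t j
      + (t == i)%:R * (alpha u * conf_coef u t j)
      - eps t * eps i * alpha t * (i == u)%:R * conf_coef u t j)); last first.
    by move=> u _; rewrite [conf_coef t i u]/conf_coef; ring.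
  rewrite sumrB big_split /= !sum_delta -mulr_sumr sum_conf_coef conf_coef_diag.
  by rewrite /conf_coef (eq_sym j) (eq_sym i t); ring.
rewrite big_split /= !sumrB big_split /= !sum_delta -!mulr_sumr sumr_const_ord.
have -> : eps i * alpha j * (eps i * alpha i) = eps i ^+ 2 * (alpha i * alpha j).
  by ring.
by rewrite !eps2; ring.
Qed.

Local Notation base := (euclidean_domain D (fun x => q x *: diag_mx (\row_i eps i))).
Local Notation W := (warped_product base f gF).
Local Notation l := (@lshift n m).
Local Notation r := (@rshift n m).
Local Notation sp p := (s (set_val p.1)).

Section Chart.
Variables (c1 : chart base) (c2 : chart gF).
Let cc : chart W := (c1, c2).

Let oD : open D. Proof. exact: open_affine_pos. Qed.
Let h1 : is_chart c1. Proof. exact: is_chart_euclidean. Qed.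
Let h2 : is_chart c2. Proof. by have [_ [ch _] _ _ _] := rF. Qed.

Lemma affine_pos (x : D) : 0 < s (set_val x).
Proof. exact: (set_valP x). Qed.

Let sp0 (p : D * F) : sp p != 0.
Proof. by rewrite gt_eqF ?affine_pos. Qed.

Let derivable_pow (C e : R) (x : D) i :
  derivable (in_coord c1 (fun x : D => C * s (set_val x) `^ e)) (coord c1 x)
    (delta_mx 0 i).
Proof.
have /(_ 1%N) [_ /(_ i) [+ _]] :=
  @smooth_on_euclidean _ _ _ _ oD c1 _ (@smooth_affine_powR _ _ alpha A c C e).
by apply; exists x.
Qed.

Let derivable_metric a b y i : dom c2 y ->
  derivable (in_coord c2 (fun y => metric c2 y a b)) (coord c2 y) (delta_mx 0 i).
Proof.
have [_ _ _ [_ sm _] _] := rF; have /(_ 1%N) [_ /(_ i) [+ _]] := sm c2 a b.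
by move=> /[swap] dy; apply; exists y.
Qed.

(** * Partial derivatives of powers of s times functions on the fibre *)

Section Point.
Variable p : D * F.
Hypothesis dp : dom cc p.
Let d2 : dom c2 p.2. Proof. by have [] := dp. Qed.

Lemma partial_pow_l (C e : R) i :
  partial cc (l i) (fun p => C * sp p `^ e) p =
  e * A * alpha i / sp p * (C * sp p `^ e).
Proof.
rewrite (partial_fst h1 h2 dp _ (fun x : D => C * s (set_val x) `^ e)).
rewrite -[lshift _ _]/(unsplit (inl _)) unsplitK.
rewrite (@partial_euclidean _ _ _ _ oD c1 i (fun x => C * s x `^ e)).
by have /@derive_val -> := is_derive_affine_powR C e i (affine_pos p.1).
Qed.

Lemma partial_fst_r (u : D -> R) i : partial cc (r i) (fun p => u p.1) p = 0.
Proof.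
by rewrite (partial_fst h1 h2 dp) -[rshift _ _]/(unsplit (inr _)) unsplitK.
Qed.

Lemma partial_snd_l (v : F -> R) i : partial cc (l i) (fun p => v p.2) p = 0.
Proof.
by rewrite (partial_snd h1 h2 dp) -[lshift _ _]/(unsplit (inl _)) unsplitK.
Qed.

Lemma partial_snd_r (v : F -> R) i :
  partial cc (r i) (fun p => v p.2) p = partial c2 i v p.2.
Proof.
by rewrite (partial_snd h1 h2 dp) -[rshift _ _]/(unsplit (inr _)) unsplitK.
Qed.

Lemma partial_powM_l (C e : R) a b i :
  partial cc (l i) (fun p => C * sp p `^ e * metric c2 p.2 a b) p =
  e * A * alpha i / sp p * (C * sp p `^ e * metric c2 p.2 a b).
Proof.
rewrite (@partial_warpedM _ _ _ _ _ _ f gF c1 c2 h1 h2 p dp _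
  (fun x : D => C * s (set_val x) `^ e) (fun y => metric c2 y a b)); last 2 first.
- by move=> ?; exact: derivable_pow.
- by move=> ?; exact: derivable_metric.
rewrite -[lshift _ _]/(unsplit (inl _)) unsplitK.
rewrite (@partial_euclidean _ _ _ _ oD c1 i (fun x => C * s x `^ e)).
have := is_derive_affine_powR C e i (affine_pos p.1) => /@derive_val ->.
by rewrite [RHS]mulrA.
Qed.

Lemma partial_powM_r (C e : R) a b i :
  partial cc (r i) (fun p => C * sp p `^ e * metric c2 p.2 a b) p =
  C * sp p `^ e * partial c2 i (fun y => metric c2 y a b) p.2.
Proof.
rewrite (@partial_warpedM _ _ _ _ _ _ f gF c1 c2 h1 h2 p dp _
  (fun x : D => C * s (set_val x) `^ e) (fun y => metric c2 y a b)).
- by rewrite -[rshift _ _]/(unsplit (inr _)) unsplitK.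
- by move=> ?; exact: derivable_pow.
- by move=> ?; exact: derivable_metric.
Qed.

Lemma partial_inv_l (C : R) i : partial cc (l i) (fun p => C / sp p) p =
  - (A * alpha i / sp p) * (C / sp p).
Proof.
have invE (p' : D * F) : C / sp p' = C * sp p' `^ (- 1).
  by rewrite powR_inv1// ltW// affine_pos.
rewrite (eq_partial _ _ (G := fun p => C * sp p `^ (- 1))) => [|p' _]; last exact: invE.
by rewrite partial_pow_l -invE; ring.
Qed.

Lemma partial_inv_r (C : R) i : partial cc (r i) (fun p => C / sp p) p = 0.
Proof. exact: (partial_fst_r (fun x => C / s (set_val x))). Qed.

End Point.

Local Notation G := (christoffel (A := W) cc).
Local Notation fib p := (f p.1 ^+ 2 / q (set_val p.1)).

Let q_neq0 (x : D) : q (set_val x) != 0.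
Proof.
rewrite qE; last exact: affine_pos.
by rewrite mulf_neq0// gt_eqF// powR_gt0// affine_pos.
Qed.

Let f2_neq0 (x : D) : f x ^+ 2 != 0.
Proof. by rewrite f2E mulf_neq0// gt_eqF// powR_gt0// affine_pos. Qed.

Let f_neq0 (x : D) : f x != 0.
Proof. by have := f2_neq0 x; rewrite expf_eq0. Qed.

Let metric_ll p i j :
  metric cc p (l i) (l j) = q (set_val p.1) * (eps i * (i == j)%:R).
Proof. by rewrite [LHS]block_mxEul !mxE mulr_natr. Qed.

Let metric_lr p i j : metric cc p (l i) (r j) = 0.
Proof. by rewrite [LHS]block_mxEur mxE. Qed.

Let metric_rl p i j : metric cc p (r i) (l j) = 0.
Proof. by rewrite [LHS]block_mxEdl mxE. Qed.

Let metric_rr p i j : metric cc p (r i) (r j) = f p.1 ^+ 2 * metric c2 p.2 i j.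
Proof. by rewrite [LHS]block_mxEdr mxE. Qed.

Let metric_rrE p i j : metric cc p (r i) (r j) =
  Cf * sp p `^ (- 2 / A) * metric c2 p.2 i j.
Proof. by rewrite metric_rr f2E. Qed.

(** * Christoffel symbols by blocks: upper index first, [l] for base and [r] for fibre *)

Section Christoffel.
Variable p : D * F.
Hypothesis dp : dom cc p.
Let d2 : dom c2 p.2. Proof. by have [] := dp. Qed.

(** The diagonal matrix of signs is its own inverse. *)
Let inv_metric : invmx (metric cc p) =
  block_mx ((q (set_val p.1))^-1 *: diag_mx (\row_i eps i)) 0
           0 ((f p.1 ^+ 2)^-1 *: invmx (metric c2 p.2)).
Proof.
apply: invmx_eq; rewrite mulmx_block !(mulmx0, mul0mx, addr0, add0r).
have [_ _ _ [/(_ c2 p.2 d2) [_ uF] _ _] _] := rF.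
rewrite -!scalemxAr -!scalemxAl !scalerA !mulVf// !scale1r mulmxV//.
rewrite mulmx_diag scalar_mx_block; congr block_mx.
apply/matrixP => i j; rewrite !mxE -expr2 eps2.
by [].
Qed.

Let inv_ll t u : invmx (metric cc p) (l t) (l u) =
  (q (set_val p.1))^-1 * eps t * (t == u)%:R.
Proof. by rewrite inv_metric block_mxEul !mxE -mulrA mulr_natr. Qed.

Let inv_lr t u : invmx (metric cc p) (l t) (r u) = 0.
Proof. by rewrite inv_metric block_mxEur mxE. Qed.

Let inv_rl t u : invmx (metric cc p) (r t) (l u) = 0.
Proof. by rewrite inv_metric block_mxEdl mxE. Qed.

Let inv_rr t u : invmx (metric cc p) (r t) (r u) =
  (f p.1 ^+ 2)^-1 * invmx (metric c2 p.2) t u.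
Proof. by rewrite inv_metric block_mxEdr mxE. Qed.

Let pm_lll t i j : partial cc (l t) (fun p => metric cc p (l i) (l j)) p =
  2 * k * alpha t / sp p * (q (set_val p.1) * (eps i * (i == j)%:R)).
Proof.
rewrite (@eq_partial _ _ _ _ _ _ _
  (fun p => Cq * (eps i * (i == j)%:R) * sp p `^ (2 * k / A))).
  by rewrite partial_pow_l// qE; [field; rewrite A0 sp0|exact: affine_pos].
by move=> p' _; rewrite metric_ll qE; [ring|exact: affine_pos].
Qed.

Let pm_rll t i j : partial cc (r t) (fun p => metric cc p (l i) (l j)) p = 0.
Proof.
by rewrite (eq_partial _ _ (fun p' _ => metric_ll p' i j));
  exact: (partial_fst_r dp (fun x => q (set_val x) * (eps i * (i == j)%:R))).
Qed.

Let pm_lr t i j : partial cc t (fun p => metric cc p (l i) (r j)) p = 0.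
Proof. by rewrite (eq_partial _ _ (fun p' _ => metric_lr p' i j)); exact: partial0. Qed.

Let pm_rl t i j : partial cc t (fun p => metric cc p (r i) (l j)) p = 0.
Proof. by rewrite (eq_partial _ _ (fun p' _ => metric_rl p' i j)); exact: partial0. Qed.

Let pm_lrr t i j : partial cc (l t) (fun p => metric cc p (r i) (r j)) p =
  - (2 * alpha t / sp p) * (f p.1 ^+ 2 * metric c2 p.2 i j).
Proof.
rewrite (eq_partial _ _ (fun p' _ => metric_rrE p' i j)).
by rewrite partial_powM_l// f2E; field; rewrite A0 sp0.
Qed.

Let pm_rrr t i j : partial cc (r t) (fun p => metric cc p (r i) (r j)) p =
  f p.1 ^+ 2 * partial c2 t (fun y => metric c2 y i j) p.2.
Proof.
rewrite (eq_partial _ _ (fun p' _ => metric_rrE p' i j)).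
by rewrite partial_powM_r// f2E.
Qed.

Let pmE := (pm_lll, pm_rll, pm_lr, pm_rl, pm_lrr, pm_rrr).

Lemma christoffel_lll t i j : G (l t) (l i) (l j) p = k * conf_coef t i j / sp p.
Proof.
rewrite /christoffel big_split_ord/= [X in _ + X]big1 ?addr0; last first.
  by move=> u _; rewrite inv_lr mul0r.
under eq_bigr do rewrite inv_ll.
rewrite sum_delta !pmE /conf_coef (eq_sym j t) (eq_sym i t).
(* All signs are moved to the index [t], where they meet the sign of the inverse metric and square
   to 1. *)
have -> : eps j * (t == j)%:R = eps t * (t == j)%:R by case: eqP => [->|]; rewrite ?mulr0.
have -> : eps i * (t == i)%:R = eps t * (t == i)%:R by case: eqP => [->|]; rewrite ?mulr0.
transitivity (k / sp p * (eps t ^+ 2 * (alpha i * (t == j)%:R + alpha j * (t == i)%:R)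
  - eps t * eps i * alpha t * (i == j)%:R)); first by field; rewrite sp0 q_neq0.
by rewrite eps2; ring.
Qed.

Lemma christoffel_llr t i j : G (l t) (l i) (r j) p = 0.
Proof.
rewrite /christoffel big_split_ord/= !big1 ?addr0 ?mulr0// => u _.
  by rewrite inv_lr mul0r.
by rewrite !pmE addr0 subr0 mulr0.
Qed.

Lemma christoffel_lrl t i j : G (l t) (r i) (l j) p = 0.
Proof.
rewrite /christoffel big_split_ord/= !big1 ?addr0 ?mulr0// => u _.
  by rewrite inv_lr mul0r.
by rewrite !pmE addr0 subr0 mulr0.
Qed.

Lemma christoffel_lrr t i j : G (l t) (r i) (r j) p =
  eps t * alpha t * fib p * metric c2 p.2 i j / sp p.
Proof.
rewrite /christoffel big_split_ord/= [X in _ + X]big1 ?addr0; last first.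
  by move=> u _; rewrite inv_lr mul0r.
under eq_bigr do rewrite inv_ll.
by rewrite sum_delta !pmE; field; rewrite sp0 q_neq0.
Qed.

Lemma christoffel_rll t i j : G (r t) (l i) (l j) p = 0.
Proof.
rewrite /christoffel big_split_ord/= !big1 ?addr0 ?mulr0// => u _.
  by rewrite !pmE addr0 subr0 mulr0.
by rewrite inv_rl mul0r.
Qed.

Let sum_invF (t j : 'I_m) :
  \sum_u invmx (metric c2 p.2) t u * metric c2 p.2 j u = (t == j)%:R.
Proof.
have [_ _ _ [/(_ c2 p.2 d2) [sF uF] _ _] _] := rF.
have /matrixP/(_ t j) := mulVmx uF; rewrite !mxE => <-.
by apply: eq_bigr => u _; have /matrixP/(_ j u) := sF; rewrite mxE => ->.
Qed.

Lemma christoffel_rlr t i j :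
  G (r t) (l i) (r j) p = - (alpha i * (t == j)%:R) / sp p.
Proof.
rewrite /christoffel big_split_ord/= [X in X + _]big1 ?add0r; last first.
  by move=> u _; rewrite inv_rl mul0r.
(* The Kronecker symbol is expanded back into a sum over the fibre metric, so that the two sides can
   be compared term by term. *)
rewrite -sum_invF !(mulr_sumr, mulr_suml) -sumrN mulr_suml.
apply: eq_bigr => u _; rewrite !pmE inv_rr.
by field; rewrite sp0 f_neq0.
Qed.

Lemma christoffel_rrl t i j :
  G (r t) (r i) (l j) p = - (alpha j * (t == i)%:R) / sp p.
Proof.
rewrite /christoffel big_split_ord/= [X in X + _]big1 ?add0r; last first.
  by move=> u _; rewrite inv_rl mul0r.
rewrite -sum_invF !(mulr_sumr, mulr_suml) -sumrN mulr_suml.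
apply: eq_bigr => u _; rewrite !pmE inv_rr.
by field; rewrite sp0 f_neq0.
Qed.

Lemma christoffel_rrr t i j :
  G (r t) (r i) (r j) p = christoffel c2 t i j p.2.
Proof.
rewrite /christoffel big_split_ord/= [X in X + _]big1 ?add0r; last first.
  by move=> u _; rewrite inv_rl mul0r.
congr (_ * _); apply: eq_bigr => u _; rewrite !pmE inv_rr.
by field; rewrite f_neq0.
Qed.

End Christoffel.

(** * Ricci tensor of the warped product, from the definition of curvature *)

Section Ricci.
Variable p : D * F.
Hypothesis dp : dom cc p.
Let d2 : dom c2 p.2. Proof. by have [] := dp. Qed.
Local Notation d := (partial (A := W) cc).

Let d_lll u t i j : d (l u) (G (l t) (l i) (l j)) p =
  - (A * alpha u / sp p) * (k * conf_coef t i j / sp p).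
Proof.
by rewrite (eq_partial _ _ (fun p' dp' => christoffel_lll dp' t i j)) partial_inv_l.
Qed.

Let d_lrr u t i j : d (l u) (G (l t) (r i) (r j)) p =
  - (2 + 2 * k + A) * alpha u / sp p
    * (eps t * alpha t * fib p * metric c2 p.2 i j / sp p).
Proof.
(* The exponent adds - 2 / A from the square of [f], - 2 k / A from 1 / q and - 1 from 1 / s; merged
   into one power, the symbol is separated and can be differentiated. *)
have GE p' : dom cc p' -> G (l t) (r i) (r j) p' = eps t * alpha t * Cf / Cq
    * sp p' `^ (- (2 + 2 * k + A) / A) * metric c2 p'.2 i j.
  move=> dp'; rewrite christoffel_lrr// f2E qE; last exact: affine_pos.
  have -> : - (2 + 2 * k + A) / A = - 2 / A - 2 * k / A - 1 by field.
  rewrite powRB1; last exact: affine_pos.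
  rewrite powRB ?sp0 ?implybT//; field.
  by rewrite sp0 Cq0 gt_eqF// powR_gt0// affine_pos.
rewrite (eq_partial _ _ GE) partial_powM_l// -GE// christoffel_lrr//.
by field; rewrite A0 sp0 q_neq0.
Qed.

Let d_rrl u t i j : d (l u) (G (r t) (r i) (l j)) p =
  A * alpha u / sp p * (alpha j * (t == i)%:R / sp p).
Proof.
by rewrite (eq_partial _ _ (fun p' dp' => christoffel_rrl dp' t i j)) partial_inv_l//; ring.
Qed.

Let d_rrr u t i j : d (l u) (G (r t) (r i) (r j)) p = 0.
Proof.
by rewrite (eq_partial _ _ (fun p' dp' => christoffel_rrr dp' t i j)) partial_snd_l.
Qed.

Let dr_lll u t i j : d (r u) (G (l t) (l i) (l j)) p = 0.
Proof.
by rewrite (eq_partial _ _ (fun p' dp' => christoffel_lll dp' t i j)) partial_inv_r.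
Qed.

Let dr_rlr u t i j : d (r u) (G (r t) (l i) (r j)) p = 0.
Proof.
by rewrite (eq_partial _ _ (fun p' dp' => christoffel_rlr dp' t i j)) partial_inv_r.
Qed.

Let dr_rrl u t i j : d (r u) (G (r t) (r i) (l j)) p = 0.
Proof.
by rewrite (eq_partial _ _ (fun p' dp' => christoffel_rrl dp' t i j)) partial_inv_r.
Qed.

Let dr_rrr u t i j : d (r u) (G (r t) (r i) (r j)) p =
  partial c2 u (christoffel c2 t i j) p.2.
Proof.
by rewrite (eq_partial _ _ (fun p' dp' => christoffel_rrr dp' t i j)) partial_snd_r.
Qed.

Let d_llr u t i j : d u (G (l t) (l i) (r j)) p = 0.
Proof.
by rewrite (eq_partial _ _ (fun p' dp' => christoffel_llr dp' t i j)) partial0.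
Qed.

Let d_lrl u t i j : d u (G (l t) (r i) (l j)) p = 0.
Proof.
by rewrite (eq_partial _ _ (fun p' dp' => christoffel_lrl dp' t i j)) partial0.
Qed.

Let d_rll u t i j : d u (G (r t) (l i) (l j)) p = 0.
Proof.
by rewrite (eq_partial _ _ (fun p' dp' => christoffel_rll dp' t i j)) partial0.
Qed.

Let christoffel_sym t i j : christoffel c2 t i j p.2 = christoffel c2 t j i p.2.
Proof.
have [_ _ _ [sF _ _] _] := rF.
rewrite /christoffel; congr (_ * _); apply: eq_bigr => u _; congr (_ * (_ - _)); first exact: addrC.
by apply: eq_partial => y dy; have [/matrixP/(_ i j) <- _] := sF c2 y dy; rewrite mxE.
Qed.

Let GE := (christoffel_lll dp, christoffel_llr dp, christoffel_lrl dp,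
  christoffel_lrr dp, christoffel_rll dp, christoffel_rlr dp,
  christoffel_rrl dp, christoffel_rrr dp).

(** The trace over base directions is the Ricci tensor of the conformally flat base. Each of the [m]
    fibre directions adds the same term - (Hess f) / f, the Hessian being that of the base. *)
Lemma ricci_ll i j : ricci cc p (l i) (l j) =
  (((n%:R * k - m%:R) * (A + 2 * k) - 2 * A * k - k ^+ 2 * (n%:R + 2) - m%:R)
     * (alpha i * alpha j)
   + k * (A - n%:R * k + m%:R + 2 * k) * (eps i * (i == j)%:R * E)) / sp p ^+ 2.
Proof.
rewrite mxE big_split_ord /=.
rewrite (eq_bigr (fun t => (- (A * k) * (alpha t * conf_coef t i j)
    + A * k * (alpha i * alpha j)
    + k ^+ 2 * (\sum_u alpha u * conf_coef u i j)
    - k ^+ 2 * \sum_u conf_coef t i u * conf_coef u t j) / sp p ^+ 2)); last first.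
  move=> t _; rewrite /curvature !d_lll big_split_ord /= [X in _ + (_ + X)]big1 ?addr0; last first.
    by move=> u _; rewrite !GE; ring.
  rewrite (eq_bigr (fun u => k ^+ 2 / sp p ^+ 2 * (alpha u * conf_coef u i j)
      - k ^+ 2 / sp p ^+ 2 * (conf_coef t i u * conf_coef u t j))); last first.
    by move=> u _; rewrite !GE !conf_coef_diag; field; rewrite sp0.
  rewrite sumrB -!mulr_sumr conf_coef_diag; field; rewrite sp0.
  by [].
(* The fibre directions: the summand is independent of [t]. *)
rewrite [X in _ + X](eq_bigr (fun t => (- (A + 1) * (alpha i * alpha j)
    - k * \sum_u alpha u * conf_coef u i j) / sp p ^+ 2)); last first.
  move=> t _; rewrite /curvature d_rll d_rrl big_split_ord /=.
  rewrite (eq_bigr (fun u => - (k / sp p ^+ 2) * (alpha u * conf_coef u i j))); last first.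
    by move=> u _; rewrite !GE eqxx !mulr1; field; rewrite sp0.
  rewrite [X in _ + (_ + X)](eq_bigr (fun u => - (alpha i * alpha j / sp p ^+ 2)
      * (t == u)%:R * (t == u)%:R)); last first.
    by move=> u _; rewrite !GE (eq_sym u t); field; rewrite sp0.
  by rewrite sum_delta -mulr_sumr eqxx !mulr1; field; rewrite sp0.
rewrite -!mulr_suml !sumrB !big_split /= -!mulr_sumr sum_conf_coef sum_conf_coef2.
rewrite !sumr_const_ord.
move: E ((i == j)%:R : R) (sp0 p) => e w sp_neq0; by field.
Qed.

Lemma ricci_lr i j : ricci cc p (l i) (r j) = 0.
Proof.
rewrite mxE big_split_ord /= big1 ?add0r; last first.
  move=> t _; rewrite /curvature !d_llr big_split_ord /= !big1 ?addr0 ?subr0// => u _;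
    by rewrite !GE; ring.
rewrite (eq_bigr (fun t => - (alpha i / sp p) * (christoffel c2 t t j p.2
   - christoffel c2 t t j p.2))); last first.
  move=> t _; rewrite /curvature dr_rlr d_rrr subr0 add0r big_split_ord /=.
  rewrite [X in X + _]big1 ?add0r; last by move=> u _; rewrite !GE; ring.
  rewrite (eq_bigr (fun u => - (alpha i / sp p) * (j == u)%:R * christoffel c2 t t u p.2
    + alpha i / sp p * (t == u)%:R * christoffel c2 u t j p.2)); last first.
    by move=> u _; rewrite !GE (eq_sym j u); ring.
  by rewrite big_split/= !sum_delta; ring.
by rewrite big1// => t _; rewrite subrr mulr0.
Qed.

(** Computed from the definition and not by symmetry of the Ricci tensor. Here the surviving terms
    cancel only after exchanging the lower indices of a Christoffel symbol of [F]. *)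
Lemma ricci_rl i j : ricci cc p (r i) (l j) = 0.
Proof.
rewrite mxE big_split_ord /= big1 ?add0r; last first.
  move=> t _; rewrite /curvature d_lrl dr_lll big_split_ord /= !big1 ?addr0 ?subr0// => u _;
    by rewrite !GE; ring.
rewrite big1// => t _; rewrite /curvature !dr_rrl subr0 add0r big_split_ord /=.
rewrite [X in X + _]big1 ?add0r; last by move=> u _; rewrite !GE; ring.
rewrite (eq_bigr (fun u => - (alpha j / sp p) * (i == u)%:R * christoffel c2 t t u p.2
    + alpha j / sp p * (t == u)%:R * christoffel c2 t i u p.2)); last first.
  by move=> u _; rewrite !GE (eq_sym i u) (eq_sym u t); ring.
by rewrite big_split/= !sum_delta (christoffel_sym t t i); ring.
Qed.

(** This is the classical Ric_F - (f Lap f + (m - 1) |grad f|^2) g_F, with Laplacian and gradient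
    taken on the base, where the logarithmic gradient of [f] has components - alpha / s. *)
Lemma ricci_rr i j : ricci cc p (r i) (r j) = ricci c2 p.2 i j +
  E * fib p * metric c2 p.2 i j / sp p ^+ 2 * (n%:R * k - m%:R - 2 * k - A).
Proof.
rewrite mxE big_split_ord /= mxE.
rewrite (eq_bigr (fun t => (1 - (2 + 2 * k + A)) * (fib p * metric c2 p.2 i j / sp p ^+ 2)
      * (eps t * alpha t ^+ 2)
    + k * (fib p * metric c2 p.2 i j / sp p ^+ 2) * E)); last first.
  move=> t _; rewrite /curvature d_lrr d_llr subr0 big_split_ord /=.
  rewrite (eq_bigr (fun u => k * (fib p * metric c2 p.2 i j / sp p ^+ 2)
      * (eps u * alpha u ^+ 2))); last first.
    by move=> u _; rewrite !GE conf_coef_diag; field; rewrite sp0 q_neq0.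
  rewrite [X in _ + (_ + X)](eq_bigr (fun u => eps t * alpha t ^+ 2 * fib p / sp p ^+ 2
      * (j == u)%:R * metric c2 p.2 i u)); last first.
    by move=> u _; rewrite !GE (eq_sym j u); field; rewrite sp0 q_neq0.
  by rewrite -mulr_sumr sum_delta; field; rewrite sp0 q_neq0.
(* The products of Christoffel symbols through fibre indices complete the curvature of [F]; those
   through base indices give the two correction terms. *)
rewrite [X in _ + X](eq_bigr (fun t => curvature c2 t j t i p.2
    - fib p * metric c2 p.2 i j / sp p ^+ 2 * E
    + E * fib p / sp p ^+ 2 * (i == t)%:R * metric c2 p.2 t j)); last first.
  move=> t _; rewrite /curvature !dr_rrr big_split_ord /=.
  rewrite (eq_bigr (fun u => - (fib p * metric c2 p.2 i j / sp p ^+ 2)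
      * (eps u * alpha u ^+ 2)
      + fib p * (t == i)%:R * metric c2 p.2 t j / sp p ^+ 2
      * (eps u * alpha u ^+ 2))); last first.
    by move=> u _; rewrite !GE eqxx !mulr1; field; rewrite sp0 q_neq0.
  rewrite [X in _ + (X + _)]big_split /= -!mulr_sumr.
  under [X in _ + (_ + X)]eq_bigr do rewrite !GE.
  rewrite (eq_sym t i).
  move: E (partial c2 t _ _) (partial c2 i _ _) (\sum_(u < m) _) ((i == t)%:R : R).
  move=> e d1 d3 Ssum w; by ring.
rewrite [X in X + _]big_split /= [X in _ + X]big_split /= sumrB sum_delta.
rewrite -!mulr_sumr !sumr_const_ord.
by move: E (\sum_t curvature c2 _ _ _ _ _) => e Scurv; ring.
Qed.

(** * Hessian of the potential and the quasi-Einstein equation *)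

Variables (Ch N : R) (h : D * F -> R).
Hypothesis hE : forall p, h p = Ch * sp p `^ (- (N / A)).

Let d_h_l p' i : dom cc p' -> d (l i) h p' = - (N * alpha i / sp p') * h p'.
Proof.
move=> dp'; rewrite (eq_partial _ _ (fun p _ => hE p)) partial_pow_l// -hE.
by field; rewrite A0 sp0.
Qed.

Let d_h_r p' i : dom cc p' -> d (r i) h p' = 0.
Proof.
move=> dp'; rewrite (eq_partial _ _ (fun p _ => hE p)).
exact: (partial_fst_r dp' (fun x => Ch * s (set_val x) `^ (- (N / A)))).
Qed.

Let d_h_ll i j : d (l i) (d (l j) h) p =
  N * (N + A) * (alpha i * alpha j) / sp p ^+ 2 * h p.
Proof.
(* The factor 1/s is absorbed into the exponent, so the power rule applies again; it contributes (N
   / A + 1) A = N + A. *)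
have dhE p' : dom cc p' -> d (l j) h p' =
    - (N * alpha j * Ch) * sp p' `^ (- (N / A) - 1).
  move=> dp'; rewrite d_h_l// hE powRB1; last exact: affine_pos.
  by field; rewrite sp0.
rewrite (eq_partial _ _ dhE) partial_pow_l// -dhE// d_h_l//.
by field; rewrite A0 sp0.
Qed.

Let d_h_rl i j : d (r i) (d (l j) h) p = 0.
Proof.
have dhE p' : dom cc p' -> d (l j) h p' =
    - (N * alpha j / sp p') * (Ch * sp p' `^ (- (N / A))).
  by move=> dp'; rewrite d_h_l// hE.
rewrite (eq_partial _ _ dhE).
exact: (partial_fst_r dp (fun x => - (N * alpha j / s (set_val x))
  * (Ch * s (set_val x) `^ (- (N / A))))).
Qed.

Let d_h_r2 i j : d i (d (r j) h) p = 0.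
Proof. by rewrite (eq_partial _ _ (fun p' dp' => d_h_r j dp')) partial0. Qed.

Lemma hessian_ll i j : hessian cc h p (l i) (l j) =
  (N * (N + A) * (alpha i * alpha j)
   + k * N * (2 * (alpha i * alpha j) - eps i * (i == j)%:R * E))
  / sp p ^+ 2 * h p.
Proof.
rewrite mxE d_h_ll big_split_ord /= [X in _ - (_ + X)]big1 ?addr0; last first.
  by move=> t _; rewrite christoffel_rll// mul0r.
rewrite -sum_conf_coef.
rewrite (eq_bigr (fun t => - (k * N * h p / sp p ^+ 2) * (alpha t * conf_coef t i j))).
  rewrite -mulr_sumr; move: (\sum_t _) (sp0 p) => S0 sp_neq0.
  by field.
by move=> t _; rewrite d_h_l// christoffel_lll//; field; rewrite sp0.
Qed.

Lemma hessian_lr i j : hessian cc h p (l i) (r j) = 0.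
Proof.
rewrite mxE d_h_r2 big_split_ord /= !big1 ?addr0 ?subr0// => t _.
  by rewrite d_h_r// mulr0.
by rewrite christoffel_llr// mul0r.
Qed.

Lemma hessian_rl i j : hessian cc h p (r i) (l j) = 0.
Proof.
rewrite mxE d_h_rl big_split_ord /= !big1 ?addr0 ?subr0// => t _.
  by rewrite d_h_r// mulr0.
by rewrite christoffel_lrl// mul0r.
Qed.

(** As [h] does not vary along the fibre, only the base component of the Christoffel symbol
    contributes. The result is f times the inner product of grad f and grad h, times the metric of
    [F]. *)
Lemma hessian_rr i j : hessian cc h p (r i) (r j) =
  N * E * fib p * metric c2 p.2 i j / sp p ^+ 2 * h p.
Proof.
rewrite mxE d_h_r2 big_split_ord /= [X in _ - (_ + X)]big1 ?addr0; last first.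
  by move=> t _; rewrite d_h_r// mulr0.
rewrite (eq_bigr (fun t => - (N * fib p * metric c2 p.2 i j / sp p ^+ 2 * h p)
    * (eps t * alpha t ^+ 2))).
  by rewrite -mulr_sumr; move: E => e; ring.
by move=> t _; rewrite d_h_l// christoffel_lrr//; field; rewrite sp0 q_neq0.
Qed.

(** The equation for [A] settles the fibre block and the part of the base block proportional to the
    metric; the second equation settles the part proportional to alpha_i alpha_j. *)
Lemma quasi_einstein_eq (rr : R) : ricci_flat gF -> h p != 0 ->
  A = (n%:R - 2) * k - m%:R - rr * N ->
  (n%:R * k - m%:R) * (A + 2 * k) - 2 * A * k - k ^+ 2 * (n%:R + 2) - m%:R
    = rr * (N * (N + A) + 2 * k * N) ->
  ricci cc p - (rr / h p) *: hessian cc h p = 0.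
Proof.
move=> flat h0 AE quadE; apply/matrixP => i j.
rewrite [LHS]mxE [X in _ + X]mxE [X in _ - X]mxE [RHS]mxE.
case: (split_ordP i) => i' ->; case: (split_ordP j) => j' ->.
- rewrite ricci_ll hessian_ll quadE.
  have -> : A - n%:R * k + m%:R + 2 * k = - (rr * N) by rewrite AE; ring.
  move: E (h p) h0 ((i' == j')%:R : R) (sp0 p) => e hp hp0 w sp_neq0.
  by field; rewrite ?hp0 ?sp_neq0.
- by rewrite ricci_lr hessian_lr mulr0 subr0.
- by rewrite ricci_rl hessian_rl mulr0 subr0.
rewrite ricci_rr hessian_rr flat// mxE add0r.
have -> : n%:R * k - m%:R - 2 * k - A = rr * N by rewrite AE; ring.
move: E (fib p) (metric c2 p.2 i' j') (h p) h0 (sp0 p) => e fp g hp hp0 sp_neq0.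
by field; rewrite ?hp0 ?sp_neq0.
Qed.

End Ricci.

End Chart.
End ConformalWarpedProduct.

(** * Exponents and conclusion *)

Lemma powR_sqr (R : realType) (x e : R) : (x `^ e) ^+ 2 = x `^ (2 * e).
Proof. by rewrite mulrC powRrM powR_mulrn// powR_ge0. Qed.

Section Exponents.
Context {R : realType}.
Variables (n m r : nat) (k : R) (plus : bool).
Hypotheses (n_ge3 : (3 <= n)%N) (m_ge1 : (1 <= m)%N) (k_gt0 : 0 < k).
Hypotheses (r_gt0 : (0 < r)%N) (r_neq1 : r <> 1%N).

Local Notation a := ((n%:R - 2) * k - m%:R).
Local Notation b := (m%:R * (2 * k + 1) - (n%:R - 2) * k ^+ 2).
Local Notation disc := (r%:R ^+ 2 * (k + a) ^+ 2 - r%:R * (r%:R - 1) * (a ^+ 2 - b)).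
Local Notation root := (Num.sqrt disc).
Local Notation N := ((r%:R * (k + a) + (if plus then root else - root))
  / (r%:R * (r%:R - 1))).
Local Notation A := (a - r%:R * N).

Hypothesis disc_ge0 : (r%:R - 1) * (a ^+ 2 - b) <= r%:R * (k + a) ^+ 2.

Let r_gt1 : 1 < r%:R :> R.
Proof. by rewrite ltr1n ltn_neqAle eq_sym r_gt0 andbT; apply/eqP. Qed.

Lemma exponent_quadratic :
  r%:R * (r%:R - 1) * N ^+ 2 - 2 * r%:R * (k + a) * N + (a ^+ 2 - b) = 0.
Proof.
have d0 : 0 <= disc.
  (* Nonnegativity is what makes the square of [Num.sqrt disc] equal to [disc], as [Num.sqrt] is 0
     on negative numbers. *)
  have -> : disc = r%:R * (r%:R * (k + a) ^+ 2 - (r%:R - 1) * (a ^+ 2 - b)) by ring.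
  by rewrite mulr_ge0// subr_ge0.
have := sqr_sqrtr d0; set s := Num.sqrt _ => s2.
have r0 : r%:R != 0 :> R by rewrite gt_eqF// (lt_trans ltr01).
have r1 : r%:R - 1 != 0 :> R by rewrite gt_eqF// subr_gt0.
set s' := if plus then s else - s.
have s'2 : s' ^+ 2 = disc by rewrite /s'; case: plus; rewrite ?sqrrN.
transitivity ((s' ^+ 2 - disc) / (r%:R * (r%:R - 1))); last by rewrite s'2 subrr mul0r.
by clearbody s'; field; rewrite r0 r1.
Qed.

(** Up to the positive factor r - 1, [A] is - (a + r k) minus the signed root. The root exceeds the
    other term in absolute value, so the choice of sign in [N] decides. *)
Lemma slope_sign : if plus then A < 0 else 0 < A.
Proof.
have n2 : 0 < n%:R - 2 :> R by rewrite subr_gt0 ltr_nat.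
have m0 : 0 < m%:R :> R by rewrite ltr0n.
have lt_root : `|a + r%:R * k| < root.
  have gap : disc - (a + r%:R * k) ^+ 2 =
      (r%:R - 1) * (a ^+ 2 + r%:R * ((n%:R - 2) * k ^+ 2 + m%:R)) by ring.
  have gap0 : 0 < disc - (a + r%:R * k) ^+ 2.
    rewrite gap mulr_gt0 ?subr_gt0// ltr_wpDl ?sqr_ge0// mulr_gt0 ?ltr0n//.
    by rewrite addr_gt0// mulr_gt0// exprn_gt0.
  rewrite -sqrtr_sqr ltr_sqrt; first by rewrite -subr_gt0.
  by rewrite (le_lt_trans (sqr_ge0 (a + r%:R * k)))// -subr_gt0.
have r0 : r%:R != 0 :> R by rewrite gt_eqF// (lt_trans ltr01).
have r1 : 0 < r%:R - 1 :> R by rewrite subr_gt0.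
have AE : A = (- (a + r%:R * k) - (if plus then root else - root)) / (r%:R - 1).
  by move: (if _ then _ else _) => s; field; rewrite r0 gt_eqF.
move: lt_root; rewrite AE; set s := root; rewrite ltr_norml => /andP[s1 s2].
case: plus.
  by rewrite pmulr_llt0 ?invr_gt0//; lra.
by rewrite divr_gt0//; lra.
Qed.

End Exponents.

Theorem theorem2p4 (R : realType) (n m r : nat)
    (eps alpha : 'I_n -> R) (i0 : 'I_n)
    (k c1 c2 c3 c : R) (plus : bool)
    (F : topologicalType) (gF : metric_atlas R m F) :
  (3 <= n)%N -> (1 <= m)%N ->
  (forall i, eps i = 1 \/ eps i = -1) ->
  \sum_i eps i * alpha i ^+ 2 = eps i0 ->
  0 < k -> 0 < c1 -> 0 < c2 -> 0 < c3 ->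
  (0 < r)%N -> r <> 1%N ->
  let a := (n%:R - 2) * k - m%:R in
  let b := m%:R * (2 * k + 1) - (n%:R - 2) * k ^+ 2 in
  (r%:R - 1) * (a ^+ 2 - b) <= r%:R * (k + a) ^+ 2 ->
  let root := Num.sqrt (r%:R ^+ 2 * (k + a) ^+ 2
                        - r%:R * (r%:R - 1) * (a ^+ 2 - b)) in
  let N := (r%:R * (k + a) + (if plus then root else - root))
           / (r%:R * (r%:R - 1)) in
  let A := a - r%:R * N in
  let xi := fun x : 'rV[R]_n => \sum_i alpha i * x 0 i in
  let f := fun t : R => c1 * (A * t + c) `^ (- (1 / A)) in
  let h := fun t : R => c2 * (A * t + c) `^ (- (N / A)) in
  let phi := fun t : R => c3 * (A * t + c) `^ (- (k / A)) in
  (* the points where the powers in f, h and phi have a positive base *)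
  let D := [set x : 'rV[R]_n | 0 < A * xi x + c] in
  let base := euclidean_domain D
    (fun x => (1 / phi (xi x) ^+ 2) *: diag_mx (\row_i eps i)) in
  semi_riemannian gF -> ricci_flat gF ->
  [/\ smooth_function base (fun x => f (xi (set_val x))),
      smooth_function base (fun x => h (xi (set_val x))),
      smooth_function base (fun x => phi (xi (set_val x))),
      quasi_einstein
        (warped_product base (fun x => f (xi (set_val x))) gF)
        r%:R (fun p => h (xi (set_val p.1))) 0 &
      (* D is a half space bounded by xi = - c / A *)
      if plus then A < 0 /\ D = [set x | xi x < - (c / A)]
      else 0 < A /\ D = [set x | xi x > - (c / A)] ].
Proof.
move=> n3 m1 epsE _ k0 c10 c20 c30 r0 r1 a b disc0 root N A xi f h phi D base rF flatF.
have Asign := slope_sign plus n3 m1 k0 r0 r1.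
have quad := exponent_quadratic plus r0 r1 disc0.
rewrite -/a -/b -/root -/N -/A in Asign quad.
have AE : A = (n%:R - 2) * k - m%:R - r%:R * N by [].
have A0 : A != 0 by move: Asign; case: (plus) => ?; [rewrite lt_eqF|rewrite gt_eqF].
have quadA : (n%:R * k - m%:R) * (A + 2 * k) - 2 * A * k - k ^+ 2 * (n%:R + 2) - m%:R
    = r%:R * (N * (N + A) + 2 * k * N).
  (* Once [A] is replaced by a - r N, the left side is a A - b and the difference of the two sides
     is exactly the quadratic polynomial of [N]. *)
  apply/eqP; rewrite -subr_eq0 -[X in _ == X]quad; apply/eqP.
  by rewrite AE /a /b; ring.
clearbody root.
have eps2 i : eps i ^+ 2 = 1 by case: (epsE i) => ->; rewrite ?sqrrN expr1n.
have oD : open D by exact: (@open_affine_pos R n alpha A c).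
have smooth_pow C e : smooth_on D (fun x => C * (A * xi x + c) `^ e).
  exact: (@smooth_affine_powR R n alpha A c).
have smooth_base C e :
    smooth_function base (fun x => C * (A * xi (set_val x) + c) `^ e).
  by move=> ch; exact: (@smooth_on_euclidean _ _ _ _ oD ch _ (smooth_pow C e)).
have qE x : D x -> 1 / phi (xi x) ^+ 2 = c3 ^- 2 * (A * xi x + c) `^ (2 * k / A).
  move=> Dx; rewrite /phi exprMn powR_sqr div1r invfM -powRN.
  by congr (_ * _ `^ _); field.
have f2E (x : D) : f (xi (set_val x)) ^+ 2 =
    c1 ^+ 2 * (A * xi (set_val x) + c) `^ (- 2 / A).
  by rewrite /f exprMn powR_sqr; congr (_ * _ `^ _); field.
have pow_neq0 C e (x : D) : 0 < C -> C * (A * xi (set_val x) + c) `^ e != 0.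
  by move=> C0; rewrite gt_eqF// mulr_gt0// powR_gt0//; exact: (set_valP x).
split; [exact: smooth_base|exact: smooth_base|exact: smooth_base| |]; last first.
  (* Dividing by [A] keeps the inequality for the minus sign and reverses it for the plus sign,
     where [A] is negative. *)
  have half x : (0 < A * xi x + c) = (- c < xi x * A).
    by apply/idP/idP => ?; lra.
  by move: Asign; case: (plus) => A_sign; split=> //; apply/seteqP;
    split=> x; rewrite /D /= half -mulNr ?ltr_ndivlMr ?ltr_pdivrMr.
have rbase : semi_riemannian base.
  apply: (@semi_riemannian_conformal _ _ _ (fun x => 1 / phi (xi x) ^+ 2)) => //.
  - move=> M; apply: class_C_eq (smooth_pow (c3 ^- 2) (2 * k / A) M) => // x Dx.
    by rewrite qE.
  - move=> x Dx; rewrite divr_gt0// exprn_gt0// mulr_gt0// powR_gt0//.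
  - exact: tr_diag_mx.
  - suff /mulmx1_unit[] : diag_mx (\row_i eps i) *m diag_mx (\row_i eps i) = 1%:M :> 'M[R]_n by [].
    rewrite mulmx_diag; apply/matrixP => i j; rewrite !mxE.
    by rewrite -expr2 eps2.
have [_ [chB _] _ _ _] := rbase; have [_ [chF _] _ _ _] := rF.
split.
- apply: semi_riemannian_warped => //; first exact: smooth_base.
  by move=> x; exact: pow_neq0.
- move=> [d1 d2]; have [od1 _ _ _] := chB d1; have [od2 _ _ _] := chF d2.
  apply: (@smooth_on_fst R n m D F base _ gF d1 d2 (chB d1) (chF d2)
    (dom d1) (dom d2) od1 od2 _ _ (fun x : D => h (xi (set_val x)))) => //.
  exact: smooth_base.
- by move=> p; exact: pow_neq0.
(* With rho = 0 the right side vanishes; the constants passed on are those of 1 / phi^2 and f^2 as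
   powers of s. *)
move=> [d1 d2] p dp; rewrite scale0r.
apply: (@quasi_einstein_eq R n m F eps alpha k A c (c3 ^- 2) (c1 ^+ 2)
    (fun x => 1 / phi (xi x) ^+ 2) (fun x => f (xi (set_val x))) gF eps2 A0 _ _ qE f2E rF
    d1 d2 p dp c2 N (fun p => h (xi (set_val p.1))) _ r%:R flatF _ AE quadA) => //.
- by rewrite invr_neq0// expf_neq0// gt_eqF.
- by rewrite expf_neq0// gt_eqF.
- exact: pow_neq0.
Qed.
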